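(* Let $(M_1,\pi_1)\stackrel{J_1}{\leftarrow}(S,\Omega)\stackrel{J_2}{\rightarrow}(M_2,\pi_2)$ be a full dual pair, and let $B_i$ be a closed $2$-form on $M_i$, $i=1,2$. Let $\widehat\Omega=\Omega+J_1^*B_1+J_2^*B_2$. Then $$(M_1,\tau_{B_1}(L_{\pi_1}))\stackrel{J_1}{\leftarrow}(S,\widehat\Omega)\stackrel{J_2}{\rightarrow}(M_2,\tau_{B_2}(L_{\pi_2}))$$ is a full pre-dual pair. Moreover, $\widehat\Omega$ is symplectic if and only if $\tau_{B_i}(L_{\pi_i})$, $i=1,2$, are Poisson, in which case they form a dual pair.
   Context: Linear Dirac structures: a Dirac structure on a finite-dimensional real vector space $V$ is a subspace $L\subset V\oplus V^*$ maximally isotropic for the pairing $\langle (x,\omega),(y,\mu)\rangle=\frac12(\omega(y)+\mu(x))$. A skew form $\Omega$ is identified with $v\mapsto\Omega(v,\cdot)$, and $\mathrm{graph}(\Omega)=\{(x,\Omega(x,\cdot))\}$; a bivector $\pi$ is identified with the map $\tilde\pi:V^*\to V$, $\eta(\tilde\pi(\nu))=\pi(\eta,\nu)$, and $\mathrm{graph}(\pi)=\{(\tilde\pi(\nu),\nu)\}$. A symplectic form $\Omega$ is viewed as the Poisson structure with $\tilde\pi$ inverse to $v\mapsto \Omega(v,\cdot)$. For a linear map $\phi:V\to W$ put $\mathcal F\phi(L)=\{(\phi(x),\eta): x\in V,\eta\in W^*,(x,\phi^*\eta)\in L\}$. A Dirac structure on a manifold $M$ is a subbundle $L\subset TM\oplus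 T^*M$ that is a linear Dirac structure at each point and whose sections are closed under the Courant bracket $((X,\omega),(Y,\mu))\mapsto([X,Y],\mathcal L_X\mu-\mathcal L_Y\omega+\frac12 d(\omega(Y)-\mu(X)))$. Closed $2$-forms (pre-symplectic forms) and Poisson structures are regarded as Dirac structures through their graphs; $L_\pi=\mathrm{graph}(\pi)$. A Dirac structure ''is Poisson'' if it is the graph of a Poisson bivector. A smooth map $\phi:(M,L_M)\to(N,L_N)$ is a Dirac map if $\mathcal F(T_x\phi)((L_M)_x)=(L_N)_{\phi(x)}$ for all $x$. Gauge transformation: for a closed $2$-form $B$ and a Dirac structure $L$ on $M$, $\tau_B(L)=\{(X,\eta+B(X,\cdot)):(X,\eta)\in L\}$, again a Dirac structure. A dual pair consists of a symplectic manifold $(S,\Omega)$, Poisson manifolds $(M_i,\pi_i)$ and Poisson maps $J_i:S\to M_i$, $i=1,2$, with $\ker T_xJ_1=(\ker T_xJ_2)^{\Omega}$ for all $x$. A pre-dual pair consists of a manifold $S$ with a closed $2$-form $\Omega$, Dirac manifolds $(M_1,L_1),(M_2,L_2)$, and Dirac maps $J_i:S\to M_i$ (where $S$ carries $\mathrm{graph}(\Omega)$) such that for all $x\in S$, $(\ker T_xJ_1)^{\Omega}=\ker T_xJ_2+\ker\Omega$ and $(\ker T_xJ_2)^{\Omega}=\ker T_xJ_1+\ker\Omega$. Here $^\Omega$ is the $\Omega$-orthogonal. A (pre-)dual pair is full if $J_1,J_2$ are surjective submersions. *)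

(* Defs.v *)
From HB Require Import structures.
From mathcomp Require Import all_boot all_order all_algebra.
From mathcomp Require Import all_classical all_reals all_analysis.
Import Order.TTheory GRing.Theory Num.Theory.
Import numFieldNormedType.Exports.

Set Implicit Arguments.
Unset Strict Implicit.
Unset Printing Implicit Defensive.

Local Open Scope classical_set_scope.
Local Open Scope ring_scope.

(* Conventions. A vector of an n-dimensional space is a row 'rV[R]_n of
   coordinates, a covector is the row of its coordinates in the dual basis.
   A linear map 'rV_m -> 'rV_n is given by the matrix A with v |-> v *m A.
   A 2-form W and a bivector P are the matrices of W(u, v) and P(eta, nu). *)

Section LinearAlgebra.
Variable R : realType.

Definition ev n (w v : 'rV[R]_n) : R := (w *m v^T) 0 0.

Definition form2 n (W : 'M[R]_n) (u v : 'rV[R]_n) : R := (u *m W *m v^T) 0 0.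

(* v |-> W(v, .) : ev (flat W v) u = form2 W v u *)
Definition flat n (W : 'M[R]_n) (v : 'rV[R]_n) : 'rV[R]_n := v *m W.

(* nu |-> P~(nu) : ev eta (sharp P nu) = form2 P eta nu *)
Definition sharp n (P : 'M[R]_n) (nu : 'rV[R]_n) : 'rV[R]_n := nu *m P^T.

Definition skew n (W : 'M[R]_n) : Prop := W^T = - W.

(* transpose of the linear map v |-> v *m A *)
Definition copull m n (A : 'M[R]_(m, n)) (eta : 'rV[R]_n) : 'rV[R]_m :=
  eta *m A^T.

Definition pull2 m n (A : 'M[R]_(m, n)) (W : 'M[R]_n) : 'M[R]_m :=
  A *m W *m A^T.

Definition lker_set m n (A : 'M[R]_(m, n)) : set 'rV[R]_m :=
  [set v | v *m A = 0].

Definition orth n (W : 'M[R]_n) (A : set 'rV[R]_n) : set 'rV[R]_n :=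
  [set u | forall v, A v -> form2 W u v = 0].

Definition form_ker n (W : 'M[R]_n) : set 'rV[R]_n :=
  [set v | flat W v = 0].

Definition set_sum n (A B : set 'rV[R]_n) : set 'rV[R]_n :=
  [set w | exists u v, [/\ A u, B v & w = u + v]].

(* R^n (+) (R^n)^*, a pair being (vector, covector) *)
Definition dbl (n : nat) : Type := ('rV[R]_n * 'rV[R]_n)%type.

Definition pairing n (z w : dbl n) : R := 2^-1 * (ev z.2 w.1 + ev w.2 z.1).

Definition is_subspace n (L : set (dbl n)) : Prop :=
  L (0, 0) /\ forall (a : R) (z w : dbl n),
    L z -> L w -> L (a *: z.1 + w.1, a *: z.2 + w.2).

Definition isotropic n (L : set (dbl n)) : Prop :=
  forall z w, L z -> L w -> pairing z w = 0.

Definition linear_dirac n (L : set (dbl n)) : Prop :=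
  [/\ is_subspace L, isotropic L &
      forall L', is_subspace L' -> isotropic L' -> L `<=` L' -> L' = L].

Definition lgraph_form n (W : 'M[R]_n) : set (dbl n) :=
  [set z | z.2 = flat W z.1].

Definition lgraph_biv n (P : 'M[R]_n) : set (dbl n) :=
  [set z | z.1 = sharp P z.2].

(* F(phi)(L) for phi = (v |-> v *m A) *)
Definition lforward m n (A : 'M[R]_(m, n)) (L : set (dbl m)) : set (dbl n) :=
  [set z | exists2 v, z.1 = v *m A & L (v, copull A z.2)].

Definition lgauge n (B : 'M[R]_n) (L : set (dbl n)) : set (dbl n) :=
  [set z | exists2 w, L w & z = (w.1, w.2 + flat B w.1)].

End LinearAlgebra.

Section SmoothOn.
Variables (R : realType) (V W : normedModType R).

Definition iter_derive (vs : seq V) (f : V -> W) : V -> W :=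
  foldr (fun v g => 'D_v g) f vs.

(* C^oo on D (meant for D open) *)
Definition smooth_on (D : set V) (f : V -> W) : Prop :=
  forall (vs : seq V) (y : V), D y -> differentiable (iter_derive vs f) y.

End SmoothOn.

Record chart (R : realType) (n : nat) (M : topologicalType) := Chart {
  cdom : set M;
  cfwd :> M -> 'rV[R]_n;
  cbwd : 'rV[R]_n -> M;
  cdom_open : open cdom;
  cimg_open : open (cfwd @` cdom);
  cfwdK : forall x, cdom x -> cbwd (cfwd x) = x;
  cfwd_continuous : forall x, cdom x -> {for x, continuous cfwd};
  cbwd_continuous :
    forall y, (cfwd @` cdom) y -> {for y, continuous cbwd} }.

(* Smooth manifold of dimension n, without boundary. The smooth structure is
   given by an atlas indexed by points, the chart of index x being a chart
   around x; it also serves to identify T_x M with R^n. *)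
Record manifold (R : realType) (n : nat) := Manifold {
  mpts :> topologicalType;
  chart_at : mpts -> chart R n mpts;
  mfd_hausdorff : hausdorff_space mpts;
  mfd_second_countable : @second_countable mpts;
  mem_chart_at : forall x, cdom (chart_at x) x;
  chart_compat : forall a b : mpts,
    smooth_on (chart_at a @` (cdom (chart_at a) `&` cdom (chart_at b)))
              (chart_at b \o cbwd (chart_at a)) }.

(* Throughout, a tangent vector, covector, 2-form, bivector at x is given by
   its coordinates in chart_at x. *)

Section Fields.
Variables (R : realType) (n : nat) (M : manifold R n).
Implicit Types (a b x p : M) (U : set M).

(* matrix of the change of coordinates from chart_at a to chart_at b at p *)
Definition dtrans a b p : 'M[R]_n :=
  jacobian (chart_at b \o cbwd (chart_at a)) (chart_at a p).

(* coordinate expressions, in chart_at a, of functions and tensor fields *)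
Definition fun_rep a (f : M -> R) : 'rV[R]_n -> R := f \o cbwd (chart_at a).

Definition vec_rep a (X : M -> 'rV[R]_n) : 'rV[R]_n -> 'rV[R]_n :=
  fun y => let p := cbwd (chart_at a) y in X p *m dtrans p a p.

Definition cov_rep a (w : M -> 'rV[R]_n) : 'rV[R]_n -> 'rV[R]_n :=
  fun y => let p := cbwd (chart_at a) y in copull (dtrans a p p) (w p).

Definition form_rep a (B : M -> 'M[R]_n) : 'rV[R]_n -> 'M[R]_n :=
  fun y => let p := cbwd (chart_at a) y in pull2 (dtrans a p p) (B p).

Definition biv_rep a (P : M -> 'M[R]_n) : 'rV[R]_n -> 'M[R]_n :=
  fun y => let p := cbwd (chart_at a) y in pull2 (dtrans p a p)^T (P p).

Definition smooth_vec U (X : M -> 'rV[R]_n) : Prop :=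
  forall a, smooth_on (chart_at a @` (cdom (chart_at a) `&` U)) (vec_rep a X).

Definition smooth_cov U (w : M -> 'rV[R]_n) : Prop :=
  forall a, smooth_on (chart_at a @` (cdom (chart_at a) `&` U)) (cov_rep a w).

Definition smooth_form (B : M -> 'M[R]_n) : Prop :=
  forall a, smooth_on (chart_at a @` cdom (chart_at a)) (form_rep a B).

Definition smooth_biv (P : M -> 'M[R]_n) : Prop :=
  forall a, smooth_on (chart_at a @` cdom (chart_at a)) (biv_rep a P).

(* The differential operators below are their usual coordinate expressions;
   at x they are computed in chart_at x. *)

Definition dfun (f : M -> R) x : 'rV[R]_n :=
  \row_i ('D_('e_i) (fun_rep x f : 'rV[R]_n -> R^o) (chart_at x x)).

Definition lie_bracket (X Y : M -> 'rV[R]_n) x : 'rV[R]_n :=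
  'D_(X x) (vec_rep x Y) (chart_at x x) - 'D_(Y x) (vec_rep x X) (chart_at x x).

(* (L_X w)_i = X^j d_j w_i + w_j d_i X^j *)
Definition lie_cov (X w : M -> 'rV[R]_n) x : 'rV[R]_n :=
  'D_(X x) (cov_rep x w) (chart_at x x)
  + w x *m (jacobian (vec_rep x X) (chart_at x x))^T.

Definition dform2 (B : M -> 'M[R]_n) x (u v w : 'rV[R]_n) : R :=
  form2 ('D_u (form_rep x B) (chart_at x x)) v w
  + form2 ('D_v (form_rep x B) (chart_at x x)) w u
  + form2 ('D_w (form_rep x B) (chart_at x x)) u v.

(* up to a constant factor, the Schouten bracket [P, P] *)
Definition schouten (P : M -> 'M[R]_n) x (al be ga : 'rV[R]_n) : R :=
  form2 ('D_(sharp (P x) al) (biv_rep x P) (chart_at x x)) be ga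
  + form2 ('D_(sharp (P x) be) (biv_rep x P) (chart_at x x)) ga al
  + form2 ('D_(sharp (P x) ga) (biv_rep x P) (chart_at x x)) al be.

Definition closed_form (B : M -> 'M[R]_n) : Prop :=
  [/\ smooth_form B, forall x, skew (B x) &
      forall x u v w, dform2 B x u v w = 0].

Definition symplectic (W : M -> 'M[R]_n) : Prop :=
  closed_form W /\ forall x, W x \in unitmx.

Definition poisson (P : M -> 'M[R]_n) : Prop :=
  [/\ smooth_biv P, forall x, skew (P x) &
      forall x al be ga, schouten P x al be ga = 0].

(* sharp of this bivector is inverse to v |-> W(v, .) *)
Definition symp_biv (W : M -> 'M[R]_n) : M -> 'M[R]_n :=
  fun x => (invmx (W x))^T.

Definition section_of (L : M -> set (dbl R n)) (z : M -> dbl R n) : Prop :=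
  [/\ smooth_vec setT (fst \o z), smooth_cov setT (snd \o z) &
      forall x, L x (z x)].

(* existence of smooth local frames *)
Definition smooth_subbundle (L : M -> set (dbl R n)) : Prop :=
  forall x : M, exists (U : set M) (k : nat) (e : 'I_k -> M -> dbl R n),
    [/\ open U, U x,
        forall i, smooth_vec U (fst \o e i) /\ smooth_cov U (snd \o e i),
        forall y, U y -> forall i, L y (e i y) &
        forall y, U y -> forall z, L y z ->
          exists! c : 'I_k -> R, z = (\sum_i c i *: (e i y).1,
                                      \sum_i c i *: (e i y).2)].

Definition courant (z1 z2 : M -> dbl R n) : M -> dbl R n := fun x =>
  let X := fst \o z1 in let om := snd \o z1 in
  let Y := fst \o z2 in let mu := snd \o z2 in
  (lie_bracket X Y x,
   lie_cov X mu x - lie_cov Y om x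
   + 2^-1 *: dfun (fun p => ev (om p) (Y p) - ev (mu p) (X p)) x).

(* The Courant bracket of smooth sections is automatically smooth, so closure
   of the sections is a pointwise membership condition. *)
Definition dirac (L : M -> set (dbl R n)) : Prop :=
  [/\ forall x, linear_dirac (L x), smooth_subbundle L &
      forall z1 z2, section_of L z1 -> section_of L z2 ->
        forall x, L x (courant z1 z2 x)].

Definition graph_form (W : M -> 'M[R]_n) : M -> set (dbl R n) :=
  fun x => lgraph_form (W x).

Definition graph_biv (P : M -> 'M[R]_n) : M -> set (dbl R n) :=
  fun x => lgraph_biv (P x).

Definition gauge (B : M -> 'M[R]_n) (L : M -> set (dbl R n)) :
  M -> set (dbl R n) := fun x => lgauge (B x) (L x).

Definition is_poisson (L : M -> set (dbl R n)) : Prop :=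
  exists2 P, poisson P & L = graph_biv P.

End Fields.

Section Maps.
Variables (R : realType) (m n : nat) (M : manifold R m) (N : manifold R n).
Implicit Types J : M -> N.

Definition smooth_map J : Prop :=
  continuous J /\ forall (a : M) (b : N),
    smooth_on (chart_at a @` (cdom (chart_at a) `&` J @^-1` cdom (chart_at b)))
              (chart_at b \o J \o cbwd (chart_at a)).

(* T_x J, as v |-> v *m tangent J x *)
Definition tangent J (x : M) : 'M[R]_(m, n) :=
  jacobian (chart_at (J x) \o J \o cbwd (chart_at x)) (chart_at x x).

Definition surj_submersion J : Prop :=
  [/\ smooth_map J, forall y, exists x, J x = y &
      forall x (w : 'rV[R]_n), exists v : 'rV[R]_m, v *m tangent J x = w].

Definition pullback2 J (B : N -> 'M[R]_n) : M -> 'M[R]_m :=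
  fun x => pull2 (tangent J x) (B (J x)).

Definition poisson_map (PM : M -> 'M[R]_m) (PN : N -> 'M[R]_n) J : Prop :=
  smooth_map J /\ forall x al be,
    form2 (PN (J x)) al be
    = form2 (PM x) (copull (tangent J x) al) (copull (tangent J x) be).

Definition dirac_map (LM : M -> set (dbl R m)) (LN : N -> set (dbl R n)) J :
  Prop :=
  smooth_map J /\ forall x, lforward (tangent J x) (LM x) = LN (J x).

End Maps.

Section DualPairs.
Variables (R : realType) (s n1 n2 : nat).
Variables (S : manifold R s) (M1 : manifold R n1) (M2 : manifold R n2).
Variables (W : S -> 'M[R]_s) (J1 : S -> M1) (J2 : S -> M2).

Definition dual_pair (P1 : M1 -> 'M[R]_n1) (P2 : M2 -> 'M[R]_n2) : Prop :=
  [/\ symplectic W, poisson P1 /\ poisson P2,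
      poisson_map (symp_biv W) P1 J1, poisson_map (symp_biv W) P2 J2 &
      forall x, lker_set (tangent J1 x)
                = orth (W x) (lker_set (tangent J2 x))].

Definition pre_dual_pair (L1 : M1 -> set (dbl R n1))
    (L2 : M2 -> set (dbl R n2)) : Prop :=
  [/\ closed_form W, dirac L1 /\ dirac L2,
      dirac_map (graph_form W) L1 J1, dirac_map (graph_form W) L2 J2 &
      forall x,
        orth (W x) (lker_set (tangent J1 x))
        = set_sum (lker_set (tangent J2 x)) (form_ker (W x))
        /\ orth (W x) (lker_set (tangent J2 x))
        = set_sum (lker_set (tangent J1 x)) (form_ker (W x))].

Definition full_dual_pair (P1 : M1 -> 'M[R]_n1) (P2 : M2 -> 'M[R]_n2) : Prop :=
  [/\ dual_pair P1 P2, surj_submersion J1 & surj_submersion J2].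

Definition full_pre_dual_pair (L1 : M1 -> set (dbl R n1))
    (L2 : M2 -> set (dbl R n2)) : Prop :=
  [/\ pre_dual_pair L1 L2, surj_submersion J1 & surj_submersion J2].

End DualPairs.

(* Main.v *)
From HB Require Import structures.
From mathcomp Require Import all_boot all_order all_algebra.
From mathcomp Require Import all_classical all_reals all_analysis.
From mathcomp Require Import ring lra.
Require Import Defs.
Import Order.TTheory GRing.Theory Num.Theory.
Import numFieldNormedType.Exports.

Set Implicit Arguments.
Unset Strict Implicit.
Unset Printing Implicit Defensive.

Local Open Scope classical_set_scope.
Local Open Scope ring_scope.

(** Write [A1], [A2] for the tangent maps of [J1], [J2] at a point of [S], [W]
for the matrix of [Omega] there and [W'] for the one of [Omega'].

At each point the theorem is linear algebra resting on one identity: for every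
covector [eta] on the target of [A1], the hamiltonian vector
[eta *m A1^T *m invmx W] lies in the kernel of [A2], and symmetrically
([lin_dual_ker]).  As the bivector on the target of
[A1] is induced by [invmx W], this makes the cross terms disappear and gives in
turn that [A1] pushes the graph of [W'] forward to the gauge transform
([lforward_gauge]), that the [W']-orthogonal of the kernel of [A1] is the sum of
the kernel of [A2] and of the kernel of [W'] ([orth_gauge]), and that [W'] is
invertible exactly when [1 + pi_i^T B_i] is invertible for both [i]
([unit_gauge_left], [unit_gauge]), which is also the condition for the gauge
transform of the graph of [pi_i] to be the graph of a bivector, [gauge_biv]
([lgauge_graph_biv], [lgauge_graph_biv_unit]).

Three facts are differential.
- [Omega'] is closed: the exterior derivative commutes with pull-back, because
  the terms containing second derivatives of the map cancel by symmetry of the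
  second derivatives ([local_pullback_closed], [closed_form_pullback]).
- The gauge transform of a Poisson structure is a Dirac structure
  ([dirac_gauge]).  For sections of the gauge transform, subtracting the
  contribution of the closed form from the Courant bracket leaves the bracket
  of the corresponding sections of the graph of the bivector, the difference
  being a value of [dB] ([courant_gauge]); and contracting the latter with a
  section of the graph gives a value of the Schouten bracket
  ([courant_schouten]).
- If the gauge transform is the graph of a bivector, this bivector is Poisson
  ([poisson_gauge]): applied to sections with constant covector part,
  the last contraction expresses its Schouten bracket through a Courant bracket
  that is already known to be a section ([schouten_gauge_biv]).

The differential statements are proved for functions on open sets of the
numerical space and transported by charts.  A tensor at [p] is recorded by its
coordinates in the chart of index [p], so its expression in a fixed chart
involves the Jacobian [dtrans] of the change of chart; the cocycle identity
[dtrans_trans] makes all algebraic operations compatible with passage to a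
chart. *)

(** * Smooth functions on open sets *)

Section Germs.
Variables (R : realType) (V W : normedModType R).
Implicit Types (f g : V -> W) (D : set V).

Lemma differentiable_near f g (x : V) :
  (\near x, f x = g x) -> differentiable f x -> differentiable g x.
Proof.
move=> fg df.
have fgx : f x = g x by apply: nbhs_singleton fg.
have cdf := diff_continuous df.
have H : g \o shift x = cst (g x) + 'd f x +o_ (0 : V) id.
  apply/eqaddoP => _/posnumP[e].
  have [_ /eqaddoP /(_ e%:num) /(_ [gt0 of e%:num]) H] := (diff_locallyP x f).1 df.
  have {}fg : \forall h \near (0 : V), f (h + x) = g (h + x).
    by move: fg; rewrite (near_shift 0)/=; apply: filterS => h /=; rewrite subr0.
  near=> h.
  have -> : (g \o shift x - (cst (g x) + 'd f x)) h
          = (f \o shift x - (cst (f x) + 'd f x)) h.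
    rewrite /= !fctE /= -fgx; congr (_ - _).
    by apply/esym; near: h.
  by near: h.
have dg := diff_unique cdf H.
by apply/diff_locallyP; rewrite dg; split.
Unshelve. all: by end_near. Qed.

Lemma open_near_eq D f g (x : V) :
  open D -> (forall y, D y -> f y = g y) -> D x -> \near x, f x = g x.
Proof.
move=> oD fg Dx; have : nbhs x D by apply: open_nbhs_nbhs.
by apply: filterS => y /fg.
Qed.

Lemma derive_eq_on D f g v (x : V) :
  open D -> (forall y, D y -> f y = g y) -> D x -> 'D_v f x = 'D_v g x.
Proof. by move=> oD fg Dx; apply/near_eq_derive/(open_near_eq oD fg). Qed.

(** [f] is [k + 1] times differentiable on [D], in the sense of iterated
directional derivatives. *)
Fixpoint diffn_on (k : nat) (D : set V) (f : V -> W) : Prop :=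
  (forall y, D y -> differentiable f y) /\
  if k is k'.+1 then forall v, diffn_on k' D ('D_v f) else True.

Lemma diffn_onW k D f : diffn_on k D f -> forall y, D y -> differentiable f y.
Proof. by case: k => [|k] []. Qed.

Lemma diffn_onS k D f : diffn_on k.+1 D f -> diffn_on k D f.
Proof.
elim: k f => [|k IH] f [df Df]; first by split.
by split => // v; apply/IH/Df.
Qed.

(** Smoothness is proved by induction on the order of differentiability, which
allows the derivative of a product or of a composite to be treated by the
induction hypothesis. *)
Lemma smooth_onP D f : smooth_on D f <-> forall k, diffn_on k D f.
Proof.
split=> [sf k|Df vs].
  elim: k f sf => [|k IH] f sf; first by split=> // y; apply: (sf [::]).
  split=> [y|v]; first exact: (sf [::]).
  apply: IH => vs y Dy; have := sf (rcons vs v) y Dy.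
  by rewrite /iter_derive foldr_rcons.
have : diffn_on (size vs) D f by [].
elim/last_ind: vs f {Df} => [|vs v IH] f; first by move=> [].
rewrite size_rcons => -[_ /(_ v)/IH].
by rewrite /iter_derive foldr_rcons.
Qed.

Lemma diffn_on_eq k D f g : open D -> (forall y, D y -> f y = g y) ->
  diffn_on k D f -> diffn_on k D g.
Proof.
move=> oD; elim: k f g => [|k IH] f g fg [df Df]; (split=> [y Dy|];
  first by apply: differentiable_near (df y Dy); apply: open_near_eq oD fg Dy).
  by [].
move=> v; apply: IH (Df v) => y Dy; exact: derive_eq_on oD fg Dy.
Qed.

Lemma smooth_on_eq D f g : open D -> (forall y, D y -> f y = g y) ->
  smooth_on D f -> smooth_on D g.
Proof.
by move=> oD fg /smooth_onP sf; apply/smooth_onP => k; apply: diffn_on_eq fg _.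
Qed.

Lemma smooth_on_sub D E f : D `<=` E -> smooth_on E f -> smooth_on D f.
Proof. by move=> DE sf vs y /DE; apply: sf. Qed.

(** Smoothness is a local property. *)
Lemma smooth_on_local D f :
  (forall y, D y -> exists E, E y /\ smooth_on E f) -> smooth_on D f.
Proof. by move=> H vs y /H[E [Ey sf]]; apply: sf. Qed.

Lemma smooth_on_differentiable D f y : smooth_on D f -> D y -> differentiable f y.
Proof. by move=> sf Dy; apply: (sf [::]). Qed.

Lemma smooth_on_derive D f v : smooth_on D f -> smooth_on D ('D_v f).
Proof.
by move=> sf vs y Dy; have := sf (rcons vs v) y Dy; rewrite /iter_derive foldr_rcons.
Qed.

Lemma diffn_on_cst k D (c : W) : open D -> diffn_on k D (cst c).
Proof.
move=> oD; elim: k c => [|k IH] c; (split=> [y Dy|]; first exact: differentiable_cst).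
  by [].
by move=> v; apply: (@diffn_on_eq k D (cst 0)) => // y _; rewrite derive_cst.
Qed.

Lemma diffn_onD k D f g : open D -> diffn_on k D f -> diffn_on k D g ->
  diffn_on k D (fun y => f y + g y).
Proof.
move=> oD; elim: k f g => [|k IH] f g [df Df] [dg Dg];
  (split=> [y Dy|]; first by apply: differentiableD; auto).
  by [].
move=> v; apply: (diffn_on_eq oD _ (IH _ _ (Df v) (Dg v))) => y Dy.
by rewrite deriveD //; apply: diff_derivable; auto.
Qed.

Lemma smooth_onD D f g : open D -> smooth_on D f -> smooth_on D g ->
  smooth_on D (fun y => f y + g y).
Proof.
move=> oD /smooth_onP sf /smooth_onP sg; apply/smooth_onP => k; exact: diffn_onD.
Qed.

Lemma smooth_on_cst D (c : W) : open D -> smooth_on D (fun=> c).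
Proof. by move=> oD; apply/smooth_onP => k; apply: diffn_on_cst. Qed.

End Germs.

Section Scalar.
Variables (R : realType) (V : normedModType R).
Implicit Types (f g : V -> R) (D : set V).

Lemma diffn_onM k D f g : open D -> diffn_on k D f -> diffn_on k D g ->
  diffn_on k D (fun y => f y * g y).
Proof.
move=> oD; elim: k f g => [|k IH] f g Hf Hg;
  (split=> [y Dy|]; first by apply: differentiableM;
    [apply: diffn_onW Hf _ _ | apply: diffn_onW Hg _ _]).
  by [].
move=> v.
have H1 : diffn_on k D (fun y => f y * 'D_v g y + g y * 'D_v f y).
  apply: diffn_onD => //; apply: IH.
  - exact: diffn_onS Hf.
  - exact: Hg.2.
  - exact: diffn_onS Hg.
  - exact: Hf.2.
apply: diffn_on_eq H1 => // y Dy.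
by rewrite deriveM //; apply: diff_derivable; [apply: diffn_onW Hf _ _ | apply: diffn_onW Hg _ _].
Qed.

Lemma diffn_onV k D f : open D -> (forall y, D y -> f y != 0) ->
  diffn_on k D f -> diffn_on k D (fun y => (f y)^-1).
Proof.
move=> oD f0; elim: k => [|k IH] Hf;
  (split=> [y Dy|]; first by apply: differentiableV; [apply: diffn_onW Hf _ _ | exact: f0]).
  by [].
move=> v; have Vf := IH (diffn_onS Hf).
have H1 : diffn_on k D (fun y => (-1 * 'D_v f y) * ((f y)^-1 * (f y)^-1)).
  do !apply: diffn_onM => //; [exact: diffn_on_cst | exact: Hf.2].
apply: diffn_on_eq H1 => // y Dy.
rewrite deriveV ?f0 //; last by apply: diff_derivable; apply: diffn_onW Hf _ _.
rewrite -[_ *: _]/(_ * _) /=; move: (f0 y Dy) => ?; by field.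
Qed.

Lemma diffn_on_sum k D (I : Type) (r : seq I) (P : pred I) (F : I -> V -> R) :
  open D -> (forall i, P i -> diffn_on k D (F i)) ->
  diffn_on k D (fun y => \sum_(i <- r | P i) F i y).
Proof.
move=> oD HF; elim: r => [|i r IH].
  by apply: diffn_on_eq (diffn_on_cst k (0 : R) oD) => // y _; rewrite big_nil.
case Pi : (P i).
  apply: diffn_on_eq (diffn_onD oD (HF i Pi) IH) => // y _.
  by rewrite big_cons Pi.
by apply: diffn_on_eq IH => // y _; rewrite big_cons Pi.
Qed.

Lemma diffn_on_prod k D (I : Type) (r : seq I) (P : pred I) (F : I -> V -> R) :
  open D -> (forall i, P i -> diffn_on k D (F i)) ->
  diffn_on k D (fun y => \prod_(i <- r | P i) F i y).
Proof.
move=> oD HF; elim: r => [|i r IH].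
  by apply: diffn_on_eq (diffn_on_cst k (1 : R) oD) => // y _; rewrite big_nil.
case Pi : (P i).
  apply: diffn_on_eq (diffn_onM oD (HF i Pi) IH) => // y _.
  by rewrite big_cons Pi.
by apply: diffn_on_eq IH => // y _; rewrite big_cons Pi.
Qed.

End Scalar.

Section Matrix.
Variables (R : realType) (V : normedModType R).
Implicit Types (D : set V).

Lemma differentiable_mxP m n (f : V -> 'M[R]_(m, n)) x :
  differentiable f x <-> forall i j, differentiable (fun y => f y i j : R) x.
Proof.
split=> [df i j|df].
  exact: (differentiable_comp df (differentiable_coord (f x) i j)).
have -> : f = \sum_i \sum_j (fun y => f y i j *: delta_mx i j : 'M[R]_(m, n)).
  apply/funext => y; rewrite fct_sumE [LHS]matrix_sum_delta.
  by apply: eq_bigr => i _; rewrite fct_sumE.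
by apply: differentiable_sum => i; apply: differentiable_sum => j;
  apply: differentiableZl.
Qed.

Lemma derive_coord m n (f : V -> 'M[R]_(m, n)) x v i j :
  differentiable f x -> ('D_v f x) i j = 'D_v (fun y => f y i j : R) x.
Proof. by move=> df; rewrite derive_mx ?mxE//; apply: diff_derivable. Qed.

Lemma diffn_on_mxP k D m n (f : V -> 'M[R]_(m, n)) : open D ->
  diffn_on k D f <-> forall i j, diffn_on k D (fun y => f y i j : R).
Proof.
move=> oD; elim: k f => [|k IH] f; split.
- by move=> [df _] i j; split=> // y /df /differentiable_mxP.
- by move=> df; split=> // y Dy; apply/differentiable_mxP => i j; apply: (df i j).1.
- move=> [df Df] i j; split=> [y /df /differentiable_mxP//|v].
  have /IH/(_ i j) := Df v; apply: diffn_on_eq => // y Dy.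
  by rewrite derive_coord//; apply: df.
- move=> df; have df' y : D y -> differentiable f y.
    by move=> Dy; apply/differentiable_mxP => i j; apply: (df i j).1.
  split=> // v; apply/IH => i j.
  have := (df i j).2 v; apply: diffn_on_eq => // y Dy.
  by rewrite derive_coord//; apply: df'.
Qed.

Lemma smooth_on_mxP D m n (f : V -> 'M[R]_(m, n)) : open D ->
  smooth_on D f <-> forall i j, smooth_on D (fun y => f y i j : R).
Proof.
move=> oD; split=> [/smooth_onP sf i j|sf]; apply/smooth_onP => k.
  by have /(diffn_on_mxP k f oD) := sf k.
by apply/diffn_on_mxP => // i j; have /smooth_onP := sf i j.
Qed.

Lemma smooth_onM D (f g : V -> R) : open D -> smooth_on D f -> smooth_on D g ->
  smooth_on D (fun y => f y * g y).
Proof.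
move=> oD /smooth_onP sf /smooth_onP sg; apply/smooth_onP => k; exact: diffn_onM.
Qed.

Lemma smooth_on_sum D (I : Type) (r : seq I) (P : pred I) (F : I -> V -> R) :
  open D -> (forall i, P i -> smooth_on D (F i)) ->
  smooth_on D (fun y => \sum_(i <- r | P i) F i y).
Proof.
move=> oD sF; apply/smooth_onP => k; apply: diffn_on_sum => // i /sF.
by move/smooth_onP.
Qed.

Lemma smooth_on_prod D (I : Type) (r : seq I) (P : pred I) (F : I -> V -> R) :
  open D -> (forall i, P i -> smooth_on D (F i)) ->
  smooth_on D (fun y => \prod_(i <- r | P i) F i y).
Proof.
move=> oD sF; apply/smooth_onP => k; apply: diffn_on_prod => // i /sF.
by move/smooth_onP.
Qed.

Lemma smooth_onV D (f : V -> R) : open D -> (forall y, D y -> f y != 0) ->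
  smooth_on D f -> smooth_on D (fun y => (f y)^-1).
Proof.
move=> oD f0 /smooth_onP sf; apply/smooth_onP => k; exact: diffn_onV.
Qed.

Lemma smooth_on_mulmx D m n p (f : V -> 'M[R]_(m, n)) (g : V -> 'M[R]_(n, p)) :
  open D -> smooth_on D f -> smooth_on D g -> smooth_on D (fun y => f y *m g y).
Proof.
move=> oD /(smooth_on_mxP _ oD) sf /(smooth_on_mxP _ oD) sg.
apply/smooth_on_mxP => // i j; apply: (@smooth_on_eq _ _ _ D
  (fun y => \sum_k f y i k * g y k j)) => // [y _|]; first by rewrite mxE.
by apply: smooth_on_sum => // k _; apply: smooth_onM.
Qed.

Lemma smooth_on_trmx D m n (f : V -> 'M[R]_(m, n)) :
  open D -> smooth_on D f -> smooth_on D (fun y => (f y)^T).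
Proof.
move=> oD /(smooth_on_mxP _ oD) sf; apply/smooth_on_mxP => // i j.
by apply: smooth_on_eq (sf j i) => // y _; rewrite mxE.
Qed.

Lemma smooth_on_det D n (f : V -> 'M[R]_n) :
  open D -> smooth_on D f -> smooth_on D (fun y => \det (f y)).
Proof.
move=> oD /(smooth_on_mxP _ oD) sf.
apply: smooth_on_sum => // s _; apply: smooth_onM => //.
  exact: smooth_on_cst.
exact: smooth_on_prod.
Qed.

Lemma smooth_on_invmx D n (f : V -> 'M[R]_n) : open D ->
  (forall y, D y -> f y \in unitmx) ->
  smooth_on D f -> smooth_on D (fun y => invmx (f y)).
Proof.
move=> oD uf sf; apply/smooth_on_mxP => // i j.
apply: (@smooth_on_eq _ _ _ D (fun y => (\det (f y))^-1 *
   ((-1) ^+ (j + i) * \det (row' j (col' i (f y)))))) => // [y Dy|].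
  by rewrite /invmx uf // !mxE.
apply: smooth_onM => //.
  apply: smooth_onV => // [y Dy|]; last exact: smooth_on_det.
  by move: (uf y Dy); rewrite unitmxE unitfE.
apply: smooth_onM => //; first exact: smooth_on_cst.
apply: smooth_on_det => //.
apply/smooth_on_mxP => // a b; move/(smooth_on_mxP _ oD): sf => sf.
by apply: smooth_on_eq (sf (lift j a) (lift i b)) => // y _; rewrite !mxE.
Qed.

Lemma is_derive_mulmx m n p (f : V -> 'M[R]_(m, n))
    (g : V -> 'M[R]_(n, p)) df dg x v :
  is_derive x v f df -> is_derive x v g dg ->
  is_derive x v (fun y => f y *m g y) (df *m g x + f x *m dg).
Proof.
move=> [Df <-] [Dg <-].
have D1 i j : is_derive x v (fun y => (f y *m g y) i j : R)
   (('D_v f x *m g x + f x *m 'D_v g x) i j).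
  have -> : (fun y => (f y *m g y) i j : R) =
     \sum_k ((fun y => f y i k : R) * (fun y => g y k j : R)).
    by apply/funext => y; rewrite fct_sumE mxE.
  have fk k : is_derive x v (fun y => f y i k : R) (('D_v f x) i k).
    apply: DeriveDef; first by move/derivable_mxP : Df.
    by rewrite derive_mx // mxE.
  have gk k : is_derive x v (fun y => g y k j : R) (('D_v g x) k j).
    apply: DeriveDef; first by move/derivable_mxP : Dg.
    by rewrite derive_mx // mxE.
  apply: is_derive_eq.
  rewrite !mxE -big_split /=; apply: eq_bigr => k _.
  by rewrite addrC; congr (_ + _); exact: mulrC.
have D2 : derivable (fun y => f y *m g y) x v.
  by apply/derivable_mxP => i j; have [] := D1 i j.
apply: DeriveDef => //; apply/matrixP => i j.
by rewrite derive_mx // mxE; have [] := D1 i j.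
Qed.

Lemma is_derive_trmx m n (f : V -> 'M[R]_(m, n)) df x v :
  is_derive x v f df -> is_derive x v (fun y => (f y)^T) df^T.
Proof.
move=> [Df <-].
have D2 : derivable (fun y => (f y)^T) x v.
  apply/derivable_mxP => i j; move/derivable_mxP : Df => /(_ j i).
  by congr (derivable _ x v); apply/funext => y; rewrite mxE.
apply: DeriveDef => //; apply/matrixP => i j.
rewrite derive_mx // mxE mxE derive_mx // mxE.
by congr (derive _ x v); apply/funext => y; rewrite mxE.
Qed.

End Matrix.

Section Composition.
Variables (R : realType) (V : normedModType R).
Implicit Types (D : set V).

Lemma derive_comp n (W : normedModType R) (f : V -> 'rV[R]_n)
    (g : 'rV[R]_n -> W) x v :
  differentiable f x -> differentiable g (f x) ->
  'D_v (g \o f) x = 'D_('D_v f x) g (f x).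
Proof.
move=> df dg; rewrite deriveE; last exact: differentiable_comp.
by rewrite diff_comp //= !deriveE.
Qed.

(** A directional derivative in terms of the partial derivatives. *)
Lemma derive_sum_coord n (g : 'rV[R]_n -> R) x u :
  differentiable g x -> 'D_u g x = \sum_i u 0 i * 'D_('e_i) g x.
Proof.
move=> dg; rewrite deriveE // {1}[u]row_sum_delta linear_sum.
by apply: eq_bigr => i _; rewrite linearZ deriveE.
Qed.

(** The derivative of [g \o f] along [v] is the sum of the products of the
components of the derivative of [f] with the partial derivatives of [g]
composed with [f]; the latter are covered by the induction hypothesis. *)
Lemma diffn_on_comp k D n (E : set 'rV[R]_n) (f : V -> 'rV[R]_n)
    (g : 'rV[R]_n -> R) : open D -> (forall y, D y -> E (f y)) ->
  smooth_on D f -> smooth_on E g -> diffn_on k D (g \o f).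
Proof.
move=> oD DE sf; elim: k g => [|k IH] g sg; (split=> [y Dy|]; first by
  apply: differentiable_comp; [apply: smooth_on_differentiable sf _ |
  apply: smooth_on_differentiable sg _; apply: DE]).
  by [].
move=> v.
have H : diffn_on k D
    (fun y => \sum_i ('D_v f y) 0 i * ('D_('e_i) g \o f) y).
  apply: diffn_on_sum => // i _; apply: diffn_onM => //.
    have /smooth_onP/(_ k) := smooth_on_derive v sf.
    by move/(diffn_on_mxP k _ oD)/(_ 0 i).
  by apply: IH; apply: smooth_on_derive.
apply: diffn_on_eq H => // y Dy.
have df := smooth_on_differentiable sf Dy.
have dg := smooth_on_differentiable sg (DE y Dy).
by rewrite derive_comp // derive_sum_coord.
Qed.

Lemma smooth_on_comp D n p q (E : set 'rV[R]_n) (f : V -> 'rV[R]_n)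
    (g : 'rV[R]_n -> 'M[R]_(p, q)) :
  open D -> open E -> (forall y, D y -> E (f y)) ->
  smooth_on D f -> smooth_on E g -> smooth_on D (g \o f).
Proof.
move=> oD oE DE sf /(smooth_on_mxP _ oE) sg; apply/smooth_on_mxP => // i j.
by apply/smooth_onP => k; apply: (diffn_on_comp k oD DE sf (sg i j)).
Qed.

End Composition.

Section Jacobian.
Variable R : realType.

Lemma jacobian_coord m n (f : 'rV[R]_m -> 'rV[R]_n) x i j :
  differentiable f x -> jacobian f x i j = ('D_('e_i) f x) 0 j.
Proof. by move=> df; rewrite (deriveEjacobian _ df) -rowE; rewrite [in RHS]mxE. Qed.

Lemma smooth_on_jacobian m n (D : set 'rV[R]_m) (f : 'rV[R]_m -> 'rV[R]_n) :
  open D -> smooth_on D f -> smooth_on D (jacobian f).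
Proof.
move=> oD sf; apply/smooth_on_mxP => // i j.
have /(smooth_on_mxP _ oD)/(_ 0 j) := smooth_on_derive 'e_i sf.
apply: smooth_on_eq => // y Dy.
by rewrite jacobian_coord //; apply: smooth_on_differentiable sf _.
Qed.

Lemma jacobian_comp m n p (f : 'rV[R]_m -> 'rV[R]_n) (g : 'rV[R]_n -> 'rV[R]_p) x :
  differentiable f x -> differentiable g (f x) ->
  jacobian (g \o f) x = jacobian f x *m jacobian g (f x).
Proof.
move=> df dg; apply/row_matrixP => i; rewrite !rowE mulmxA.
rewrite -[LHS]deriveEjacobian; last exact: differentiable_comp.
by rewrite derive_comp // !deriveEjacobian.
Qed.

Lemma jacobian_near_id m (f : 'rV[R]_m -> 'rV[R]_m) x :
  (\near x, f x = x) -> jacobian f x = 1%:M.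
Proof.
move=> fid; have nid : \near x, id x = f x by move: fid; apply: filterS => y ->.
have df : differentiable f x by apply: differentiable_near nid _.
apply/row_matrixP => i; rewrite !rowE -deriveEjacobian // mulmx1.
by rewrite (near_eq_derive _ fid) derive_id.
Qed.

Lemma jacobian_near m n (f g : 'rV[R]_m -> 'rV[R]_n) x :
  (\near x, f x = g x) -> differentiable f x -> jacobian f x = jacobian g x.
Proof.
move=> fg df; have dg := differentiable_near fg df.
apply/row_matrixP => i; rewrite [LHS]rowE [RHS]rowE.
have Ef := deriveEjacobian 'e_i df; have Eg := deriveEjacobian 'e_i dg.
apply: etrans (esym Ef) _; apply: etrans _ Eg.
exact: near_eq_derive fg.
Qed.

End Jacobian.

(** * Symmetry of second derivatives *)

Section Schwarz.
Variables (R : realType) (V : normedModType R).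
Implicit Types (f : V -> R) (D : set V).

(** The derivative of the restriction of [f] to the line through [a] along [u]. *)
Lemma is_derive_line f (a u : V) (s : R) :
  derivable f (a + s *: u) u ->
  is_derive s (1 : R) (fun r : R => f (a + r *: u)) ('D_u f (a + s *: u)).
Proof.
have E : (fun h => h^-1 *: (((fun r : R => f (a + r *: u)) \o shift s) (h *: 1)
            - f (a + s *: u))) =
         (fun h => h^-1 *: ((f \o shift (a + s *: u)) (h *: u) - f (a + s *: u))).
  apply/funext => h /=; congr (_ *: (f _ - _)).
  by rewrite scalerDl -[h *: 1]/(h * 1) mulr1 addrCA.
move=> df; apply: DeriveDef; first by rewrite /derivable /= E.
by rewrite /derive /= E.
Qed.

Lemma nbhs_parallelogram (x u v : V) (A : set V) : nbhs x A ->
  exists2 h : R, 0 < h & forall s t : R, 0 <= s <= h -> 0 <= t <= h ->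
    A (x + s *: u + t *: v).
Proof.
move=> /nbhs_ballP[r /= r0 rA].
have c0 : 0 < `|u| + `|v| + 1 by rewrite ltr_wpDl ?addr_ge0.
exists (r / (`|u| + `|v| + 1)); first by rewrite divr_gt0.
move=> s t /andP[s0 sh] /andP[t0 th]; apply: rA.
rewrite -ball_normE /= -addrA opprD addrA subrr add0r normrN.
apply: le_lt_trans (ler_normD _ _) _; rewrite !normrZ !ger0_norm //.
apply: (@le_lt_trans _ _ (r / (`|u| + `|v| + 1) * (`|u| + `|v|))).
  by rewrite mulrDr lerD // ler_wpM2r.
by rewrite -mulrA gtr_pMr // mulrC ltr_pdivrMr // mul1r ltrDl.
Qed.

(** The second difference of [f] along [u] and [v] is a mixed second
derivative at an intermediate point. *)
Lemma second_difference f (x u v : V) (h : R) : 0 < h ->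
  (forall s t : R, 0 <= s <= h -> 0 <= t <= h ->
     differentiable f (x + s *: u + t *: v) /\
     differentiable ('D_u f) (x + s *: u + t *: v)) ->
  exists s t : R, [/\ 0 <= s <= h, 0 <= t <= h &
    f (x + h *: u + h *: v) - f (x + h *: u) - f (x + h *: v) + f x
    = 'D_v ('D_u f) (x + s *: u + t *: v) * h * h].
Proof.
move=> h0 df.
have hh : 0 <= h <= h by apply/andP; split; [exact: ltW|exact: lexx].
have zh : 0 <= (0 : R) <= h by apply/andP; split; [exact: lexx|exact: ltW].
have d1 (s : R) : 0 <= s <= h -> is_derive s (1 : R)
    ((fun s : R => f (x + h *: v + s *: u)) - (fun s : R => f (x + s *: u)))
    ('D_u f (x + h *: v + s *: u) - 'D_u f (x + s *: u)).
  move=> sh; have L : is_derive s (1 : R) (fun s : R => f (x + h *: v + s *: u))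
      ('D_u f (x + h *: v + s *: u)).
    apply: is_derive_line; apply: diff_derivable.
    by rewrite addrAC; apply: (df s h sh hh).1.
  have L' : is_derive s (1 : R) (fun s : R => f (x + s *: u)) ('D_u f (x + s *: u)).
    apply: is_derive_line; apply: diff_derivable.
    by have := (df s 0 sh zh).1; rewrite scale0r addr0.
  exact: is_deriveB.
have [||s sh Es] := MVT_segment (ltW h0)
  (f := ((fun s : R => f (x + h *: v + s *: u)) - (fun s : R => f (x + s *: u))))
  (df := fun s => 'D_u f (x + h *: v + s *: u) - 'D_u f (x + s *: u)).
- move=> s; rewrite in_itv /= => /andP[s0 s1]; apply: d1; rewrite !ltW //.
- apply: derivable_within_continuous => s; rewrite in_itv /= => sh.
  by have [] := d1 s sh.
have {}sh : 0 <= s <= h by move: sh; rewrite in_itv.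
have d2 (t : R) : 0 <= t <= h -> is_derive t (1 : R)
    (fun t : R => 'D_u f (x + s *: u + t *: v)) ('D_v ('D_u f) (x + s *: u + t *: v)).
  move=> th; apply: is_derive_line; apply: diff_derivable.
  exact: (df s t sh th).2.
have [||t th Et] := MVT_segment (ltW h0)
  (f := fun t : R => 'D_u f (x + s *: u + t *: v))
  (df := fun t => 'D_v ('D_u f) (x + s *: u + t *: v)).
- move=> t; rewrite in_itv /= => /andP[t0 t1]; apply: d2; rewrite !ltW //.
- apply: derivable_within_continuous => t; rewrite in_itv /= => th.
  by have [] := d2 t th.
exists s, t; split => //.
move: Es Et; rewrite !fctE !scale0r !addr0 !subr0 ![_ + h *: v + _]addrAC.
move=> Es Et; rewrite -Et -Es; ring.
Qed.

(** Symmetry of second derivatives. *)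
Lemma derive_derive_sym D f (x u v : V) : open D -> smooth_on D f -> D x ->
  'D_u ('D_v f) x = 'D_v ('D_u f) x.
Proof.
move=> oD sf Dx.
have su := smooth_on_derive u sf; have sv := smooth_on_derive v sf.
have cuv : {for x, continuous ('D_u ('D_v f))}.
  by apply/differentiable_continuous/(smooth_on_differentiable (smooth_on_derive u sv)).
have cvu : {for x, continuous ('D_v ('D_u f))}.
  by apply/differentiable_continuous/(smooth_on_differentiable (smooth_on_derive v su)).
apply/eqP; rewrite -subr_eq0 -normr_le0; apply/ler_addgt0Pr => e e0; rewrite add0r.
have e20 : 0 < e / 2 by rewrite divr_gt0.
have ND : nbhs x D by apply: open_nbhs_nbhs.
have N1 : \forall y \near x, `|'D_u ('D_v f) x - 'D_u ('D_v f) y| < e / 2.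
  by move/cvgrPdist_lt: cuv => /(_ _ e20).
have N2 : \forall y \near x, `|'D_v ('D_u f) x - 'D_v ('D_u f) y| < e / 2.
  by move/cvgrPdist_lt: cvu => /(_ _ e20).
have [h h0 Ah] := nbhs_parallelogram u v (filterI ND (filterI N1 N2)).
have [s [t [sh th E1]]] : exists s t : R, [/\ 0 <= s <= h, 0 <= t <= h &
    f (x + h *: u + h *: v) - f (x + h *: u) - f (x + h *: v) + f x
    = 'D_v ('D_u f) (x + s *: u + t *: v) * h * h].
  apply: second_difference => // s t sh th; have [Dst _] := Ah s t sh th.
  by split; [apply: smooth_on_differentiable sf _|apply: smooth_on_differentiable su _].
have [t' [s' [th' sh' E2]]] : exists s t : R, [/\ 0 <= s <= h, 0 <= t <= h &
    f (x + h *: v + h *: u) - f (x + h *: v) - f (x + h *: u) + f x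
    = 'D_u ('D_v f) (x + s *: v + t *: u) * h * h].
  apply: second_difference => // s' t' sh' th'; rewrite addrAC.
  have [Dst _] := Ah t' s' th' sh'.
  by split; [apply: smooth_on_differentiable sf _|apply: smooth_on_differentiable sv _].
rewrite [x + t' *: v + s' *: u]addrAC in E2.
have E : 'D_v ('D_u f) (x + s *: u + t *: v) = 'D_u ('D_v f) (x + s' *: u + t' *: v).
  have hh : h * h != 0 by rewrite mulf_neq0 ?gt_eqF.
  move: E1 E2; rewrite [x + h *: v + h *: u]addrAC.
  move: (f _) (f _) (f _) (f _) ('D_v _ _) ('D_u _ _) => a b c d p q E1 E2.
  by apply: (mulIf hh); rewrite !mulrA -E1 -E2; ring.
have [_ [_ B2]] := Ah s t sh th.
have [_ [B1 _]] := Ah s' t' sh' th'.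
have tri (a b c : R) : `|a - b| <= `|a - c| + `|b - c|.
  by rewrite [`|b - c|]distrC; apply: le_trans _ (ler_normD _ _); rewrite addrA subrK.
apply: le_trans (tri _ _ ('D_u ('D_v f) (x + s' *: u + t' *: v))) _.
rewrite [e]splitr; apply: lerD; first exact: ltW.
by apply: ltW; rewrite -E.
Qed.

End Schwarz.

Lemma derive_derive_coord (R : realType) (V : normedModType R) m n (D : set V)
    (f : V -> 'M[R]_(m, n)) (x u v : V) i j : open D -> smooth_on D f -> D x ->
  ('D_u ('D_v f) x) i j = 'D_u ('D_v (fun y => f y i j : R)) x.
Proof.
move=> oD sf Dx.
have dv := smooth_on_differentiable (smooth_on_derive v sf) Dx.
apply: etrans (derive_coord u i j dv) _.
apply: derive_eq_on Dx => // y Dy.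
exact: derive_coord (smooth_on_differentiable sf Dy).
Qed.

(** Symmetry of second derivatives for matrix-valued functions. *)
Lemma derive_derive_sym_mx (R : realType) (V : normedModType R) m n (D : set V)
    (f : V -> 'M[R]_(m, n)) (x u v : V) : open D -> smooth_on D f -> D x ->
  'D_u ('D_v f) x = 'D_v ('D_u f) x.
Proof.
move=> oD sf Dx; apply/matrixP => i j.
apply: etrans (derive_derive_coord u v i j oD sf Dx) _.
apply: etrans _ (esym (derive_derive_coord v u i j oD sf Dx)).
apply: derive_derive_sym Dx => //.
by move/(smooth_on_mxP f oD): sf.
Qed.

(** * Bilinear forms in coordinates *)

Section BilinearForms.
Variable R : realType.

Lemma trmx11 (M : 'M[R]_1) : M^T 0 0 = M 0 0.
Proof. by rewrite mxE. Qed.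

Lemma evC n (u v : 'rV[R]_n) : ev u v = ev v u.
Proof. by rewrite /ev -trmx11 trmx_mul trmxK. Qed.

Lemma evDl n (u v w : 'rV[R]_n) : ev (u + v) w = ev u w + ev v w.
Proof. by rewrite /ev mulmxDl mxE. Qed.

Lemma evNl n (u w : 'rV[R]_n) : ev (- u) w = - ev u w.
Proof. by rewrite /ev mulNmx mxE. Qed.

Lemma evDr n (u v w : 'rV[R]_n) : ev w (u + v) = ev w u + ev w v.
Proof. by rewrite !(evC w) evDl. Qed.

Lemma evNr n (u w : 'rV[R]_n) : ev w (- u) = - ev w u.
Proof. by rewrite !(evC w) evNl. Qed.

(** The transpose of a linear map is its adjoint for the evaluation pairing. *)
Lemma ev_mul m n (u : 'rV[R]_m) (A : 'M[R]_(m, n)) (v : 'rV[R]_n) :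
  ev (u *m A) v = ev u (v *m A^T).
Proof. by rewrite /ev trmx_mul trmxK mulmxA. Qed.

Lemma form2E n (W : 'M[R]_n) u v : form2 W u v = ev (u *m W) v.
Proof. by []. Qed.

Lemma form2_tr n (W : 'M[R]_n) u v : form2 W^T u v = form2 W v u.
Proof. by rewrite !form2E evC -ev_mul. Qed.

Lemma form2N n (W : 'M[R]_n) u v : form2 (- W) u v = - form2 W u v.
Proof. by rewrite !form2E mulmxN evNl. Qed.

Lemma form2D n (W W' : 'M[R]_n) u v : form2 (W + W') u v = form2 W u v + form2 W' u v.
Proof. by rewrite !form2E mulmxDr evDl. Qed.

Lemma form2_skew n (W : 'M[R]_n) u v : skew W -> form2 W u v = - form2 W v u.
Proof. by move=> sW; rewrite -form2_tr sW form2N. Qed.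

Lemma form2_pull m n (A : 'M[R]_(m, n)) (B : 'M[R]_n) u v :
  form2 (pull2 A B) u v = form2 B (u *m A) (v *m A).
Proof. by rewrite !form2E /pull2 !mulmxA ev_mul trmxK. Qed.

Lemma ev_eq0 n (u : 'rV[R]_n) : (forall v, ev u v = 0) -> u = 0.
Proof.
move=> u0; apply/rowP => i; have := u0 'e_i.
by rewrite /ev trmx_delta -colE !mxE.
Qed.

Lemma ev_inj n (u v : 'rV[R]_n) : (forall w, ev u w = ev v w) -> u = v.
Proof.
move=> uv; apply/eqP; rewrite -subr_eq0; apply/eqP/ev_eq0 => w.
by rewrite evDl evNl uv subrr.
Qed.

Lemma mulmx_inj m n (A B : 'M[R]_(m, n)) :
  (forall u : 'rV_m, u *m A = u *m B) -> A = B.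
Proof. by move=> AB; apply/row_matrixP => i; rewrite !rowE. Qed.

Lemma form2_inj n (W W' : 'M[R]_n) :
  (forall u v, form2 W u v = form2 W' u v) -> W = W'.
Proof. by move=> E; apply: mulmx_inj => u; apply: ev_inj => w; apply: E. Qed.

Lemma unitmx_inj n (A : 'M[R]_n) :
  (forall u : 'rV_n, u *m A = 0 -> u = 0) -> A \in unitmx.
Proof.
move=> injA; rewrite -row_free_unit -kermx_eq0; apply/eqP/row_matrixP => i.
by rewrite row0; apply: injA; rewrite -row_mul mulmx_ker row0.
Qed.

Lemma skew_pull m n (A : 'M[R]_(m, n)) (B : 'M[R]_n) : skew B -> skew (pull2 A B).
Proof. by move=> sB; rewrite /skew /pull2 !trmx_mul trmxK sB mulNmx mulmxN mulmxA. Qed.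

Lemma skewD n (W W' : 'M[R]_n) : skew W -> skew W' -> skew (W + W').
Proof. by rewrite /skew linearD /= => -> ->; rewrite opprD. Qed.

(** A covector vanishing on the kernel of [A] factors through [A]. *)
Lemma annihilator_ker m n (A : 'M[R]_(m, n)) (r : 'rV[R]_m) :
  (forall v : 'rV_m, v *m A = 0 -> ev r v = 0) -> exists eta, r = eta *m A^T.
Proof.
move=> H; apply/submxP; rewrite submxE; apply/eqP/rowP => j.
pose c := (col j (cokermx A^T))^T.
have cA : c *m A = 0.
  by apply/trmx_inj; rewrite trmx_mul trmx0 trmxK colE mulmxA mulmx_coker mul0mx.
have := H _ cA; rewrite /ev trmxK colE mulmxA -colE => E.
by rewrite !mxE; move: E; rewrite !mxE.
Qed.

(** The transpose of a surjective map is injective. *)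
Lemma surj_copull_inj m n (A : 'M[R]_(m, n)) :
  (forall w : 'rV_n, exists v : 'rV_m, v *m A = w) ->
  forall eta : 'rV_n, eta *m A^T = 0 -> eta = 0.
Proof.
move=> sA eta E; apply: ev_eq0 => w; have [v <-] := sA w.
by rewrite evC ev_mul E /ev trmx0 mulmx0 mxE.
Qed.

End BilinearForms.

(** * Linear dual pairs and gauge transformations *)

Section LinearDualPair.
Variable R : realType.

(** The pointwise content of a dual pair: [W] is a symplectic form and the
kernel of [A1] is the orthogonal of the kernel of [A2].  The roles of [A1] and
[A2] are symmetric by [lin_dualC]. *)
Definition lin_dual s n1 n2 (W : 'M[R]_s) (A1 : 'M[R]_(s, n1))
    (A2 : 'M[R]_(s, n2)) : Prop :=
  [/\ skew W, W \in unitmx & lker_set A1 = orth W (lker_set A2)].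

(** The symplectic orthogonal is an involution on subspaces. *)
Lemma lin_dualC s n1 n2 (W : 'M[R]_s) (A1 : 'M[R]_(s, n1)) (A2 : 'M[R]_(s, n2)) :
  lin_dual W A1 A2 -> lin_dual W A2 A1.
Proof.
move=> [sW uW E]; split=> //; apply/seteqP; split=> v.
  move=> kv u; rewrite E => ku; rewrite form2_skew //; apply/eqP.
  by rewrite oppr_eq0; apply/eqP/ku.
move=> Hv.
have [|eta Eeta] := @annihilator_ker R _ _ (W *m (kermx A2)^T) (v *m W).
  move=> u uK; apply: (Hv u); rewrite E => w kw.
  have /sub_kermxP/submxP[c ->] : w *m A2 = 0 := kw.
  by rewrite /form2 trmx_mul !mulmxA -(mulmxA u) uK mul0mx mxE.
move: Eeta; rewrite trmx_mul trmxK sW mulmxN mulmxN mulmxA -mulNmx.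
move/(congr1 (mulmx^~ (invmx W))); rewrite !mulmxK // => ->.
by rewrite /lker_set /= mulNmx -mulmxA mulmx_ker mulmx0 oppr0.
Qed.

(** The hamiltonian vector of a covector pulled back along [A1] is killed by
[A2]. *)
Lemma lin_dual_ker s n1 n2 (W : 'M[R]_s) (A1 : 'M[R]_(s, n1))
    (A2 : 'M[R]_(s, n2)) (eta : 'rV[R]_n1) :
  lin_dual W A1 A2 -> eta *m A1^T *m invmx W *m A2 = 0.
Proof.
move=> /lin_dualC[sW uW E].
suff : lker_set A2 (eta *m A1^T *m invmx W) by [].
rewrite E => u ku; rewrite form2E mulmxKV // ev_mul trmxK ku.
by rewrite /ev trmx0 mulmx0 mxE.
Qed.

Section Gauged.
Variables (s n1 n2 : nat) (W : 'M[R]_s).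
Variables (A1 : 'M[R]_(s, n1)) (A2 : 'M[R]_(s, n2)).
Variables (B1 : 'M[R]_n1) (B2 : 'M[R]_n2).
Hypothesis dW : lin_dual W A1 A2.

Let W' := W + pull2 A1 B1 + pull2 A2 B2.
(* the matrix of the map from covectors to vectors given by the bivector that W
   induces on the target of A1 *)
Let Q1 := A1^T *m invmx W *m A1.

Let flatW' (v : 'rV_s) :
  v *m W' = v *m W + v *m A1 *m B1 *m A1^T + v *m A2 *m B2 *m A2^T.
Proof. by rewrite /W' !mulmxDr /pull2 !mulmxA. Qed.

(** [A1] is a Dirac map from the graph of [W'] to the gauge transform. *)
Lemma lforward_gauge (P1 : 'M[R]_n1) : P1^T = Q1 ->
  lforward A1 (lgraph_form W') = lgauge B1 (lgraph_biv P1).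
Proof.
have uW : W \in unitmx by case: dW.
have H21 (b : 'rV_n2) := lin_dual_ker b (lin_dualC dW).
move=> PQ; apply/seteqP; split=> [[X ze]|[X ze]].
  rewrite /lforward /lgraph_form /= /flat /copull => -[v -> E].
  exists (v *m A1, ze - v *m A1 *m B1) => /=; last by rewrite /flat subrK.
  rewrite /lgraph_biv /= /sharp PQ /Q1.
  have : (ze - v *m A1 *m B1) *m A1^T = v *m W + v *m A2 *m B2 *m A2^T.
    by rewrite mulmxBl E flatW' addrAC addrK.
  rewrite !mulmxA => ->; rewrite mulmxDl mulmxK // mulmxDl -[_ *m A2^T *m _]mulmxA.
  by rewrite (mulmxA _ A2^T) H21 addr0.
move=> [[Y eta]]; rewrite /lgraph_biv /= /sharp PQ => -> [-> ->].
exists (eta *m A1^T *m invmx W); first by rewrite /Q1 !mulmxA.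
rewrite /lgraph_form /= /flat flatW' mulmxKV // (lin_dual_ker eta dW).
by rewrite !mul0mx addr0 /copull mulmxDl /Q1 !mulmxA.
Qed.

Lemma orth_gauge :
  orth W' (lker_set A1) = set_sum (lker_set A2) (form_ker W').
Proof.
have [sW uW E1] := dW; have [_ _ E2] := lin_dualC dW.
have H21 (b : 'rV_n2) := lin_dual_ker b (lin_dualC dW).
apply/seteqP; split=> u.
  move=> Hu.
  have [|eta Eeta] := @annihilator_ker R _ _ A1 (u *m W + u *m A2 *m B2 *m A2^T).
    move=> v vA1; have := Hu v vA1; rewrite form2E flatW' !evDl.
    have -> : ev (u *m A1 *m B1 *m A1^T) v = 0.
      by rewrite ev_mul trmxK vA1 /ev trmx0 mulmx0 mxE.
    by rewrite addr0.
  (* u is the sum of a hamiltonian vector, which lies in ker A2, and of k; since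
     k and u have the same image under A2, k is in the kernel of W' *)
  pose b := u *m A2 *m B2; pose k := - (b *m A2^T *m invmx W).
  have Eu : u = eta *m A1^T *m invmx W + k.
    by rewrite -Eeta mulmxDl mulmxK // addrK.
  have kA1 : k *m A1 = 0 by rewrite /k mulNmx H21 oppr0.
  have kA2 : k *m A2 = u *m A2.
    by rewrite [in RHS]Eu mulmxDl (lin_dual_ker eta dW) add0r.
  exists (eta *m A1^T *m invmx W), k; split=> //; first exact: lin_dual_ker.
  rewrite /form_ker /= /flat flatW' kA1 kA2 !mul0mx addr0 -/b.
  by rewrite {1}/k mulNmx mulmxKV // addNr.
move=> [v [k [vA2 kW' ->]]] w wA1.
rewrite form2E mulmxDl [k *m W']kW' addr0 flatW' vA2 !mul0mx addr0 evDl.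
have -> : ev (v *m A1 *m B1 *m A1^T) w = 0.
  by rewrite ev_mul trmxK wA1 /ev trmx0 mulmx0 mxE.
by rewrite addr0; have : lker_set A2 v by []; rewrite E2; apply.
Qed.

(** If [eta] is killed by [1 + P1^T B1], then [eta *m A1^T *m invmx W] is in the
kernel of [W']. *)
Lemma unit_gauge_left (P1 : 'M[R]_n1) : P1^T = Q1 ->
  (forall w : 'rV_n1, exists v : 'rV_s, v *m A1 = w) ->
  W' \in unitmx -> 1%:M + P1^T *m B1 \in unitmx.
Proof.
have uW : W \in unitmx by case: dW.
move=> -> sA1 uW'; apply: unitmx_inj => eta E.
apply: (surj_copull_inj sA1).
have : eta *m A1^T *m invmx W *m W' = 0.
  rewrite flatW' mulmxKV // (lin_dual_ker eta dW) !mul0mx addr0.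
  have := congr1 (mulmx^~ A1^T) E.
  by rewrite mulmxDr mulmx1 mul0mx mulmxDl /Q1 !mulmxA.
move/(congr1 (mulmx^~ (invmx W'))); rewrite mulmxK // mul0mx.
by move/(congr1 (mulmx^~ W)); rewrite mulmxKV // mul0mx.
Qed.

(** If [v] is in the kernel of [W'], then the covectors [v *m A1 *m B1] and
[v *m A2 *m B2] are killed by [1 + P1^T B1] and [1 + P2^T B2], and they
determine [v]. *)
Lemma unit_gauge (P1 : 'M[R]_n1) (P2 : 'M[R]_n2) : P1^T = Q1 ->
  P2^T = A2^T *m invmx W *m A2 ->
  1%:M + P1^T *m B1 \in unitmx -> 1%:M + P2^T *m B2 \in unitmx ->
  W' \in unitmx.
Proof.
have uW : W \in unitmx by case: dW.
have H12 (b : 'rV_n1) := lin_dual_ker b dW.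
have H21 (b : 'rV_n2) := lin_dual_ker b (lin_dualC dW).
move=> E1 E2 u1 u2; apply: unitmx_inj => v.
rewrite flatW' -addrA => /eqP; rewrite addr_eq0 => /eqP vW.
have {}vW : v = - (v *m A1 *m B1 *m A1^T *m invmx W + v *m A2 *m B2 *m A2^T *m invmx W).
  by rewrite -mulmxDl -mulNmx -vW mulmxK.
have vA1 : v *m A1 = - (v *m A1 *m B1 *m P1^T).
  by rewrite {1}vW mulNmx mulmxDl H21 addr0 E1 /Q1 !mulmxA.
have vA2 : v *m A2 = - (v *m A2 *m B2 *m P2^T).
  by rewrite {1}vW mulNmx mulmxDl H12 add0r E2 !mulmxA.
have key n (P B : 'M[R]_n) (X : 'rV_n) : 1%:M + P^T *m B \in unitmx ->
    X = - (X *m B *m P^T) -> X *m B = 0.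
  move=> uN EX; have : X *m B *m (1%:M + P^T *m B) = 0.
    by rewrite mulmxDr mulmx1 mulmxA -[_ *m P^T]opprK -EX mulNmx subrr.
  by move/(congr1 (mulmx^~ (invmx (1%:M + P^T *m B)))); rewrite mulmxK // mul0mx.
by rewrite vW (key _ _ _ _ u1 vA1) (key _ _ _ _ u2 vA2) !mul0mx addr0 oppr0.
Qed.

End Gauged.

End LinearDualPair.

Section LinearGauge.
Variables (R : realType) (n : nat).
Implicit Types (P B : 'M[R]_n).

(** The bivector whose graph is the gauge transform of the graph of [P]. *)
Definition gauge_biv B P : 'M[R]_n := (invmx (1%:M + P^T *m B) *m P^T)^T.

Lemma lgauge_graph_biv P B : 1%:M + P^T *m B \in unitmx ->
  lgauge B (lgraph_biv P) = lgraph_biv (gauge_biv B P).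
Proof.
move=> uN; apply/seteqP; split=> [[X ze]|[X ze]].
  move=> [[Y eta]]; rewrite /lgraph_biv /= /sharp => -> [-> ->].
  rewrite /flat trmxK mulmxA; congr (_ *m _).
  by rewrite -[X in X + _]mulmx1 -mulmxA -mulmxDr mulmxK.
rewrite /lgraph_biv /= /sharp trmxK => ->.
exists (ze *m invmx (1%:M + P^T *m B) *m P^T, ze *m invmx (1%:M + P^T *m B)) => //=.
congr pair; rewrite ?mulmxA // /flat -mulmxA -[X in X + _]mulmx1 -mulmxDr.
by rewrite mulmxKV.
Qed.

Lemma lgauge_graph_biv_unit P B P' :
  lgauge B (lgraph_biv P) = lgraph_biv P' -> 1%:M + P^T *m B \in unitmx.
Proof.
move=> E; apply: unitmx_inj => eta N0.
have : lgauge B (lgraph_biv P) (eta *m P^T, 0).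
  exists (eta *m P^T, eta) => //=; rewrite -N0 /flat.
  by rewrite mulmxDr mulmx1 mulmxA.
rewrite E /lgraph_biv /= /sharp mul0mx => eP.
by move: N0; rewrite mulmxDr mulmxA eP mul0mx addr0 mulmx1.
Qed.

Lemma gauge_biv_eq P B : 1%:M + P^T *m B \in unitmx ->
  (gauge_biv B P)^T = (1%:M - (gauge_biv B P)^T *m B) *m P^T.
Proof.
move=> uN; rewrite trmxK; set N := 1%:M + _.
apply: (can_inj (mulKmx uN)).
rewrite [RHS]mulmxA !mulmxBr !mulmx1 !mulmxA !mulmxV // !mul1mx.
by rewrite /N addrK mul1mx.
Qed.

Lemma gauge_biv_skew P B : 1%:M + P^T *m B \in unitmx ->
  skew P -> skew B -> skew (gauge_biv B P).
Proof.
move=> uN sP sB; set N := 1%:M + P^T *m B.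
have E : N *m P^T = P^T *m N^T.
  rewrite /N linearD /= trmx1 trmx_mul trmxK mulmxDl mulmxDr mul1mx mulmx1 sB sP.
  by rewrite !(mulmxN, mulNmx) mulmxA.
rewrite /skew trmxK /gauge_biv -/N trmx_mul trmxK trmx_inv.
have uNT : N^T \in unitmx by rewrite unitmx_tr.
have sP' : P^T = - P := sP.
rewrite -mulNmx -sP'.
by apply: (can_inj (mulKmx uN)); rewrite mulKVmx // mulmxA E mulmxK.
Qed.

(** Maximality: a pair orthogonal to the whole gauge transform of the graph
belongs to it. *)
Lemma linear_dirac_gauge P B : skew P -> skew B ->
  linear_dirac (lgauge B (lgraph_biv P)).
Proof.
move=> sP sB; split.
- split; first by exists (0, 0); rewrite /lgraph_biv /= /sharp ?mul0mx // /flat mul0mx addr0.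
  move=> a z w [[X eta] /= EX ->] [[Y mu] /= EY ->] /=.
  exists (a *: X + Y, a *: eta + mu); rewrite /lgraph_biv /=.
    have {}EX : X = eta *m P^T := EX; have {}EY : Y = mu *m P^T := EY.
    by rewrite EX EY /sharp mulmxDl scalemxAl.
  by rewrite /flat mulmxDl -scalemxAl scalerDr addrACA.
- move=> z w [[X eta] /= EX ->] [[Y mu] /= EY ->].
  rewrite /pairing /= !evDl -[ev (flat B X) Y]/(form2 B X Y).
  rewrite -[ev (flat B Y) X]/(form2 B Y X) (form2_skew Y X sB).
  have {}EX : X = eta *m P^T := EX; have {}EY : Y = mu *m P^T := EY.
  rewrite EX EY -!ev_mul -!form2E (form2_skew eta mu sP).
  by rewrite addrACA addNr addrN addr0 mulr0.
- move=> L' _ iL' LL'; apply/seteqP; split=> // -[X om] L'z.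
  exists (X, om - X *m B); last by rewrite /= /flat subrK.
  rewrite /lgraph_biv /=; apply: ev_inj => eta.
  have : pairing (X, om) (eta *m P^T, eta + eta *m P^T *m B) = 0.
    by apply: iL' => //; apply: LL'; exists (eta *m P^T, eta).
  rewrite /pairing /= => /eqP; rewrite mulf_eq0 invr_eq0 pnatr_eq0 /= => /eqP.
  rewrite evDl -ev_mul -(form2E B) (form2_skew _ _ sB) [ev eta X]evC !form2E => E.
  have {E} -> : ev X eta = ev (X *m B) (eta *m P^T) - ev (om *m P) eta.
    by apply/eqP; rewrite eq_sym subr_eq; apply/eqP; move: E => /eqP; lra.
  have sP' : P^T = - P := sP.
  rewrite /sharp mulmxBl evDl evNl (ev_mul (X *m B)) trmxK sP' !mulmxN evNr evNl.
  exact: addrC.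
Qed.

End LinearGauge.

Section NondegenerateForm.
Variable R : realType.

(** For nondegenerate [W], Dirac maps onto graphs of bivectors are Poisson maps. *)
Lemma lforward_graph_biv s n (W : 'M[R]_s) (A : 'M[R]_(s, n)) (P : 'M[R]_n) al be :
  W \in unitmx -> lforward A (lgraph_form W) = lgraph_biv P ->
  form2 P al be = form2 (invmx W)^T (copull A al) (copull A be).
Proof.
move=> uW E.
have : lforward A (lgraph_form W) (be *m A^T *m invmx W *m A, be).
  by exists (be *m A^T *m invmx W) => //; rewrite /lgraph_form /= /flat mulmxKV.
rewrite E /lgraph_biv /= /sharp => EP.
rewrite -form2_tr form2E -EP form2_tr form2E /copull.
by rewrite ev_mul.
Qed.

Lemma set_sum_nondegenerate n (W : 'M[R]_n) (A : set 'rV[R]_n) : W \in unitmx ->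
  set_sum A (form_ker W) = A.
Proof.
move=> uW; apply/seteqP; split=> [u [v [k [Av]]]|u Au].
  rewrite /form_ker /= /flat => /(congr1 (mulmx^~ (invmx W))).
  by rewrite mulmxK // mul0mx => -> ->; rewrite addr0.
by exists u, 0; split; rewrite ?addr0 // /form_ker /= /flat mul0mx.
Qed.

End NondegenerateForm.

(** * The Courant bracket on open sets of the numerical space *)

Section LocalCourant.
Variables (R : realType) (n : nat).
Implicit Types (X Y om mu eta ka : 'rV[R]_n -> 'rV[R]_n) (P B : 'rV[R]_n -> 'M[R]_n).
Implicit Types (y w : 'rV[R]_n).

Lemma derive_mulmx p q r (f : 'rV[R]_n -> 'M[R]_(p, q))
    (g : 'rV[R]_n -> 'M[R]_(q, r)) y w :
  differentiable f y -> differentiable g y ->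
  'D_w (fun z => f z *m g z) y = 'D_w f y *m g y + f y *m 'D_w g y.
Proof.
move=> /(@diff_derivable _ _ _ _ _ w)/derivableP df.
move=> /(@diff_derivable _ _ _ _ _ w)/derivableP dg.
exact: (@derive_val _ _ _ _ _ _ _ (is_derive_mulmx df dg)).
Qed.

Lemma derive_trmx p q (f : 'rV[R]_n -> 'M[R]_(p, q)) y w :
  differentiable f y -> 'D_w (fun z => (f z)^T) y = ('D_w f y)^T.
Proof.
move=> /(@diff_derivable _ _ _ _ _ w)/derivableP df.
exact: (@derive_val _ _ _ _ _ _ _ (is_derive_trmx df)).
Qed.

Lemma differentiable_trmx p q (f : 'rV[R]_n -> 'M[R]_(p, q)) y :
  differentiable f y -> differentiable (fun z => (f z)^T) y.
Proof.
move/differentiable_mxP => df; apply/differentiable_mxP => i j.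
by have := df j i; congr (differentiable _ _); apply/funext => z; rewrite mxE.
Qed.

Lemma differentiable_mulmx p q r (f : 'rV[R]_n -> 'M[R]_(p, q))
    (g : 'rV[R]_n -> 'M[R]_(q, r)) y :
  differentiable f y -> differentiable g y ->
  differentiable (fun z => f z *m g z) y.
Proof.
move=> /differentiable_mxP df /differentiable_mxP dg; apply/differentiable_mxP => i j.
have -> : (fun z => (f z *m g z) i j : R) =
    \sum_k ((fun z => f z i k : R) * (fun z => g z k j : R)).
  by apply/funext => z; rewrite fct_sumE mxE.
by apply: differentiable_sum => k; apply: differentiableM.
Qed.

Lemma differentiable_ev X om y :
  differentiable X y -> differentiable om y ->
  differentiable (fun z => ev (om z) (X z)) y.
Proof.
move=> dX dom; have := differentiable_mulmx dom (differentiable_trmx dX).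
by move/differentiable_mxP/(_ 0 0).
Qed.

Lemma derive_ev X om y w : differentiable X y -> differentiable om y ->
  'D_w (fun z => ev (om z) (X z)) y = ev ('D_w om y) (X y) + ev (om y) ('D_w X y).
Proof.
move=> dX dom; have dXT := differentiable_trmx dX.
have := derive_coord w 0 0 (differentiable_mulmx dom dXT).
move/esym => E; apply: etrans E _.
by rewrite derive_mulmx // derive_trmx // mxE.
Qed.

(** The components of the Courant bracket of the fields [(X, om)] and
[(Y, mu)] of an open subset of the numerical space. *)
Definition lbracket X Y y := 'D_(X y) Y y - 'D_(Y y) X y.

Definition lcourant X om Y mu y : 'rV[R]_n :=
  ('D_(X y) mu y + mu y *m (jacobian X y)^T)
  - ('D_(Y y) om y + om y *m (jacobian Y y)^T)
  + 2^-1 *: \row_i ('D_('e_i) (fun z => ev (om z) (Y z) - ev (mu z) (X z) : R^o) y).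

(** For fields spanning an isotropic subbundle, the covector part of the bracket
simplifies, as [ev om Y] and [ev mu X] are opposite. *)
Lemma ev_lcourant X om Y mu y w :
  differentiable X y -> differentiable om y ->
  differentiable Y y -> differentiable mu y ->
  (\near y, ev (om y) (Y y) + ev (mu y) (X y) = 0) ->
  ev (lcourant X om Y mu y) w =
  ev ('D_(X y) mu y) w - ev ('D_(Y y) om y) w
  + ev (mu y) ('D_w X y) + ev ('D_w om y) (Y y).
Proof.
move=> dX dom dY dmu iso.
have dg := differentiable_ev dY dom.
have rowE' : 2^-1 *: \row_i ('D_('e_i) (fun z => ev (om z) (Y z) - ev (mu z) (X z) : R^o) y)
    = \row_i ('D_('e_i) (fun z => ev (om z) (Y z)) y) :> 'rV[R]_n.
  apply/rowP => i; rewrite !mxE.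
  have -> : 'D_('e_i) (fun z => ev (om z) (Y z) - ev (mu z) (X z) : R^o) y
      = 2 * 'D_('e_i) (fun z => ev (om z) (Y z) : R) y.
    rewrite -[RHS]/(2 *: _) -deriveZ; last exact: diff_derivable.
    apply: near_eq_derive.
    move: iso; apply: filterS => z /eqP; rewrite addrC addr_eq0 => /eqP ->.
    by rewrite opprK -[RHS]/(2 * _) mulr2n mulrDl !mul1r.
  by apply: mulKf; rewrite pnatr_eq0.
have rw : ev (\row_i ('D_('e_i) (fun z => ev (om z) (Y z)) y)) w
     = ev ('D_w om y) (Y y) + ev (om y) ('D_w Y y).
  rewrite -derive_ev // derive_sum_coord // /ev mxE.
  by apply: eq_bigr => i _; rewrite !mxE mulrC.
have eJ (a : 'rV[R]_n) Z : differentiable Z y ->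
    ev (a *m (jacobian Z y)^T) w = ev a ('D_w Z y).
  by move=> dZ; rewrite ev_mul trmxK (deriveEjacobian _ dZ).
have eX := eJ (mu y) X dX; have eY := eJ (om y) Y dY.
rewrite /lcourant rowE'.
move: rw eX eY.
move: ('D_(X y) mu y) ('D_(Y y) om y) ('D_w om y) ('D_w Y y) ('D_w X y) => a b c d e.
move: (\row_i _) (mu y *m _) (om y *m _) => r p q rw eX eY.
rewrite !(evDl, evNl) rw eX eY; ring.
Qed.

(** Derivatives of a field of skew matrices are skew. *)
Lemma derive_skew P y w : differentiable P y -> (\near y, skew (P y)) ->
  skew ('D_w P y).
Proof.
move=> dP sP; rewrite /skew -derive_trmx // -deriveN; last exact: diff_derivable.
by apply: near_eq_derive; move: sP; apply: filterS => z.
Qed.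

(** Contracting the Courant bracket of two sections of the graph of a bivector
with the section of covector part [ga] gives, up to sign, the Schouten bracket.
Here [theta] is the covector part of the bracket, in the form given by
[ev_lcourant]. *)
Lemma courant_schouten P X Y eta ka y (theta ga : 'rV[R]_n) :
  differentiable P y -> differentiable eta y -> differentiable ka y ->
  (\near y, skew (P y)) ->
  (\near y, X y = sharp (P y) (eta y)) -> (\near y, Y y = sharp (P y) (ka y)) ->
  (forall w, ev theta w = ev ('D_(X y) ka y) w - ev ('D_(Y y) eta y) w
                          + ev (ka y) ('D_w X y) + ev ('D_w eta y) (Y y)) ->
  ev ga (lbracket X Y y) + ev theta (sharp (P y) ga) =
  - (form2 ('D_(sharp (P y) (eta y)) P y) (ka y) ga
     + form2 ('D_(sharp (P y) (ka y)) P y) ga (eta y)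
     + form2 ('D_(sharp (P y) ga) P y) (eta y) (ka y)).
Proof.
move=> dP deta dka sP EX EY Eth.
have dPT := differentiable_trmx dP.
have dX w : 'D_w X y = 'D_w eta y *m (P y)^T + eta y *m ('D_w P y)^T.
  by rewrite (near_eq_derive _ EX) /sharp derive_mulmx // derive_trmx.
have dY w : 'D_w Y y = 'D_w ka y *m (P y)^T + ka y *m ('D_w P y)^T.
  by rewrite (near_eq_derive _ EY) /sharp derive_mulmx // derive_trmx.
have sdP w := derive_skew w dP sP.
have sPy : skew (P y) by apply: nbhs_singleton sP.
rewrite Eth /lbracket.
have EXy : X y = sharp (P y) (eta y) by apply: (nbhs_singleton EX).
have EYy : Y y = sharp (P y) (ka y) by apply: (nbhs_singleton EY).
rewrite !dX !dY -EXy -EYy.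
have Zl (u : 'rV[R]_n) : ev ga (u *m (P y)^T) = - ev u (sharp (P y) ga).
  by rewrite /sharp evC -form2E form2_tr form2_skew // -form2_tr form2E evC.
have Yl (u : 'rV[R]_n) : ev (ka y) (u *m (P y)^T) = - ev u (Y y).
  by rewrite EYy /sharp evC -form2E form2_tr form2_skew // -form2_tr form2E evC.
have dl (Q : 'M[R]_n) (a b : 'rV[R]_n) : skew Q -> ev a (b *m Q^T) = - form2 Q b a.
  by move=> sQ; rewrite evC -form2E form2_tr form2_skew.
move: (sharp (P y) ga) Zl => Z Zl.
move: (sdP (X y)) (sdP (Y y)) (sdP Z).
move: ('D_(X y) P y) ('D_(Y y) P y) ('D_Z P y) => PX PY PZ sX sY sZ.
move: ('D_(X y) ka y) ('D_(Y y) eta y) ('D_Z eta y) => kX eY eZ.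
rewrite !(evDr, evNr) (dl PX) // (dl PY) // (dl PZ) // !Zl Yl.
rewrite (form2_skew (eta y) ga sY).
ring.
Qed.

(** The covector part of the Courant bracket of two gauge-transformed sections
is the gauge transform of the one of the original sections. *)
Lemma courant_gauge B X Y eta ka om mu y w :
  differentiable B y -> differentiable X y -> differentiable Y y ->
  differentiable eta y -> differentiable ka y ->
  (\near y, skew (B y)) ->
  (\near y, om y = eta y + flat (B y) (X y)) ->
  (\near y, mu y = ka y + flat (B y) (Y y)) ->
  (forall u v w, form2 ('D_u B y) v w + form2 ('D_v B y) w u
                 + form2 ('D_w B y) u v = 0) ->
  ev ('D_(X y) mu y) w - ev ('D_(Y y) om y) w
  + ev (mu y) ('D_w X y) + ev ('D_w om y) (Y y)
  - ev (flat (B y) (lbracket X Y y)) w =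
  ev ('D_(X y) ka y) w - ev ('D_(Y y) eta y) w
  + ev (ka y) ('D_w X y) + ev ('D_w eta y) (Y y).
Proof.
move=> dB dX dY deta dka sB Eom Emu cB.
have dom u : 'D_u om y = 'D_u eta y + ('D_u X y *m B y + X y *m 'D_u B y).
  rewrite (near_eq_derive _ Eom) deriveD ?derive_mulmx //; apply: diff_derivable => //.
  exact: differentiable_mulmx.
have dmu u : 'D_u mu y = 'D_u ka y + ('D_u Y y *m B y + Y y *m 'D_u B y).
  rewrite (near_eq_derive _ Emu) deriveD ?derive_mulmx //; apply: diff_derivable => //.
  exact: differentiable_mulmx.
have Emuy : mu y = ka y + Y y *m B y by apply: (nbhs_singleton Emu).
have sdB u := derive_skew u dB sB.
have sBy : skew (B y) by apply: nbhs_singleton sB.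
rewrite !dom !dmu Emuy /flat /lbracket.
have := cB (X y) (Y y) w; move: (sdB (X y)) (sdB (Y y)) (sdB w).
move: ('D_(X y) B y) ('D_(Y y) B y) ('D_w B y) => BX BY Bw sX sY sw.
move: ('D_(X y) ka y) ('D_(Y y) eta y) ('D_w eta y) ('D_w X y) ('D_(X y) Y y) ('D_(Y y) X y).
move=> a b c d e f cl.
rewrite mulmxBl !(evDl, evNl) -!form2E.
rewrite (form2_skew w (X y) sY) in cl.
rewrite (form2_skew d (Y y) sBy).
have {}cl : form2 Bw (X y) (Y y) = form2 BY (X y) w - form2 BX (Y y) w.
  by apply/eqP; rewrite -subr_eq0 -cl; apply/eqP; ring.
rewrite cl; ring.
Qed.

End LocalCourant.

Section LocalGauge.
Variables (R : realType) (n : nat).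
Implicit Types (X Y om mu : 'rV[R]_n -> 'rV[R]_n) (P B : 'rV[R]_n -> 'M[R]_n).
Implicit Types (y w : 'rV[R]_n).

Lemma ev_sharp_skew (P : 'M[R]_n) (al be : 'rV[R]_n) :
  skew P -> ev al (sharp P be) = - ev be (sharp P al).
Proof.
move=> sP; rewrite [in LHS]/sharp -ev_mul -form2E form2_skew // form2E ev_mul.
by [].
Qed.

(** The gauge transform of a Poisson structure by a closed form is closed under
the Courant bracket. *)
Lemma lcourant_gauge P B X Y om mu y :
  differentiable P y -> differentiable B y ->
  differentiable X y -> differentiable Y y ->
  differentiable om y -> differentiable mu y ->
  (\near y, skew (P y)) -> (\near y, skew (B y)) ->
  (\near y, X y = sharp (P y) (om y - flat (B y) (X y))) ->
  (\near y, Y y = sharp (P y) (mu y - flat (B y) (Y y))) ->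
  (forall u v w, form2 ('D_u B y) v w + form2 ('D_v B y) w u
                 + form2 ('D_w B y) u v = 0) ->
  (forall al be ga, form2 ('D_(sharp (P y) al) P y) be ga
     + form2 ('D_(sharp (P y) be) P y) ga al
     + form2 ('D_(sharp (P y) ga) P y) al be = 0) ->
  lgauge (B y) (lgraph_biv (P y)) (lbracket X Y y, lcourant X om Y mu y).
Proof.
move=> dP dB dX dY dom dmu sP sB EX EY cB sch.
(* the corresponding sections of the graph of P have covector parts eta and ka *)
pose eta z := om z - flat (B z) (X z); pose ka z := mu z - flat (B z) (Y z).
have deta : differentiable eta y.
  by apply: differentiableB => //; apply: differentiable_mulmx.
have dka : differentiable ka y.
  by apply: differentiableB => //; apply: differentiable_mulmx.
have iso : \near y, ev (om y) (Y y) + ev (mu y) (X y) = 0.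
  near=> z.
  have sPz : skew (P z) by near: z.
  have sBz : skew (B z) by near: z.
  have EXz : X z = sharp (P z) (eta z) by near: z.
  have EYz : Y z = sharp (P z) (ka z) by near: z.
  have -> : om z = eta z + flat (B z) (X z) by rewrite subrK.
  have -> : mu z = ka z + flat (B z) (Y z) by rewrite subrK.
  rewrite (evDl (eta z)) (evDl (ka z)) -[ev (flat _ _) (Y z)]/(form2 _ _ _).
  rewrite -[ev (flat _ _) (X z)]/(form2 _ _ _) (form2_skew (Y z) _ sBz).
  have -> : ev (eta z) (Y z) = - ev (ka z) (X z).
    by rewrite [Y z]EYz (ev_sharp_skew _ _ sPz) -EXz.
  by rewrite addrACA addNr addrN addr0.
pose th := lcourant X om Y mu y - flat (B y) (lbracket X Y y).
exists (lbracket X Y y, th); last by rewrite /th /= subrK.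
rewrite /lgraph_biv /=; apply: ev_inj => ga.
have sPy : skew (P y) by apply: nbhs_singleton sP.
rewrite [RHS]evC ev_sharp_skew // [LHS]evC.
apply/eqP; rewrite -addr_eq0; apply/eqP.
have H := @courant_schouten R n P X Y eta ka y th ga dP deta dka sP EX EY.
rewrite H; first by rewrite sch oppr0.
move=> w; rewrite {1}/th evDl evNl ev_lcourant //.
apply: courant_gauge => //.
  by near=> z; rewrite /eta subrK.
by near=> z; rewrite /ka subrK.
Unshelve. all: by end_near. Qed.

(** The gauge transform of a Poisson bivector by a closed form, when it is
again a bivector, has vanishing Schouten bracket: the Courant bracket of its
sections with constant covector parts [al] and [be] is again a section. *)
Lemma schouten_gauge_biv P B (P' : 'rV[R]_n -> 'M[R]_n) y (al be ga : 'rV[R]_n) :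
  differentiable P y -> differentiable B y -> differentiable P' y ->
  (\near y, skew (P y)) -> (\near y, skew (B y)) ->
  (\near y, 1%:M + (P y)^T *m B y \in unitmx) ->
  (\near y, P' y = gauge_biv (B y) (P y)) ->
  (forall u v w, form2 ('D_u B y) v w + form2 ('D_v B y) w u
                 + form2 ('D_w B y) u v = 0) ->
  (forall al be ga, form2 ('D_(sharp (P y) al) P y) be ga
     + form2 ('D_(sharp (P y) be) P y) ga al
     + form2 ('D_(sharp (P y) ga) P y) al be = 0) ->
  form2 ('D_(sharp (P' y) al) P' y) be ga
     + form2 ('D_(sharp (P' y) be) P' y) ga al
     + form2 ('D_(sharp (P' y) ga) P' y) al be = 0.
Proof.
move=> dP dB dP' sP sB uN EP' cB sch.
have sP' : \near y, skew (P' y).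
  near=> z; rewrite (_ : P' z = gauge_biv (B z) (P z)); last by near: z.
  by apply: gauge_biv_skew; near: z.
pose X (c : 'rV[R]_n) z := sharp (P' z) c.
have dX c : differentiable (X c) y.
  by apply: differentiable_mulmx => //; apply: differentiable_trmx.
have EX c : \near y, X c y = sharp (P y) (c - flat (B y) (X c y)).
  near=> z.
  have uz : 1%:M + (P z)^T *m B z \in unitmx by near: z.
  have Ez : P' z = gauge_biv (B z) (P z) by near: z.
  rewrite /X /sharp /flat Ez {1}(gauge_biv_eq uz).
  by rewrite !mulmxA mulmxBr mulmx1 !mulmxA.
have dc (c : 'rV[R]_n) : differentiable (cst c : 'rV[R]_n -> 'rV[R]_n) y by [].
have := lcourant_gauge dP dB (dX al) (dX be) (dc al) (dc be) sP sB (EX al) (EX be) cB sch.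
rewrite lgauge_graph_biv; last by apply: nbhs_singleton uN.
rewrite -(nbhs_singleton EP') /lgraph_biv /= => C1.
have sP'y : skew (P' y) by apply: nbhs_singleton sP'.
have nX c : \near y, X c y = sharp (P' y) (cst c y) by near=> z.
have H := @courant_schouten R n P' (X al) (X be) (cst al) (cst be) y
  (lcourant (X al) (cst al) (X be) (cst be) y) ga dP' (dc al) (dc be) sP'
  (nX al) (nX be).
move: H; rewrite C1 (ev_sharp_skew ga) // addNr => H.
apply/eqP; rewrite -oppr_eq0; apply/eqP/esym; apply: H => w.
apply: ev_lcourant => //.
near=> z; rewrite /= (ev_sharp_skew al) ?addNr //.
by near: z.
Unshelve. all: by end_near. Qed.

(** Gauge transformation commutes with a linear change of coordinates. *)
Lemma gauge_biv_pull (T T' B P : 'M[R]_n) : T *m T' = 1%:M ->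
  1%:M + P^T *m B \in unitmx ->
  1%:M + (pull2 T'^T P)^T *m pull2 T B \in unitmx /\
  gauge_biv (pull2 T B) (pull2 T'^T P) = pull2 T'^T (gauge_biv B P).
Proof.
move=> TT' uN; have T'T := mulmx1C TT'.
have TT't : T'^T *m T^T = 1%:M by rewrite -trmx_mul TT' trmx1.
have T'Tt : T^T *m T'^T = 1%:M by rewrite -trmx_mul T'T trmx1.
have EN : 1%:M + (pull2 T'^T P)^T *m pull2 T B = T'^T *m (1%:M + P^T *m B) *m T^T.
  rewrite mulmxDr mulmx1 mulmxDl TT't /pull2 !trmx_mul trmxK; congr (_ + _).
  by rewrite !mulmxA -[_ *m T' *m T]mulmxA T'T mulmx1.
have uN' : 1%:M + (pull2 T'^T P)^T *m pull2 T B \in unitmx.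
  rewrite EN !unitmx_mul uN andbT; apply/andP; split.
    by have [] := mulmx1_unit TT't.
  by have [] := mulmx1_unit T'Tt.
split=> //; apply: trmx_inj; apply: (can_inj (mulKmx uN')).
rewrite trmxK mulKVmx // EN /pull2 !trmx_mul !trmxK !mulmxA.
rewrite -[_ *m T^T *m T'^T]mulmxA T'Tt mulmx1 -[_ *m (1%:M + _) *m _]mulmxA.
by rewrite mulmxV // mulmx1.
Qed.

End LocalGauge.

(** * Charts and changes of coordinates *)

Section Charts.
Variables (R : realType) (n : nat) (M : manifold R n).
Implicit Types (a b c p x : M) (U : set M).

Lemma cbwdK a p : cdom (chart_at a) p -> cbwd (chart_at a) (chart_at a p) = p.
Proof. exact: cfwdK. Qed.

Lemma cdom_self x : cdom (chart_at x) x.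
Proof. exact: mem_chart_at. Qed.

(** Charts are open maps. *)
Lemma chart_img_open a U : open U ->
  open (chart_at a @` (cdom (chart_at a) `&` U)).
Proof.
move=> oU; rewrite openE => _ [p [ap Up] <-].
have imgp : (chart_at a @` cdom (chart_at a)) (chart_at a p) by exists p.
have N1 : nbhs (chart_at a p) (chart_at a @` cdom (chart_at a)).
  by apply: open_nbhs_nbhs; split=> //; apply: cimg_open.
have N2 : nbhs (chart_at a p) (cbwd (chart_at a) @^-1` U).
  apply: (cbwd_continuous imgp); rewrite cbwdK //.
  exact: open_nbhs_nbhs.
apply: filterS (filterI N1 N2) => _ [[q aq <-]] /=.
by rewrite cbwdK // => Uq; exists q.
Qed.

Lemma chart_img_openT a : open (chart_at a @` cdom (chart_at a)).
Proof. exact: cimg_open. Qed.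

Lemma nbhs_chart_img a p U : open U -> cdom (chart_at a) p -> U p ->
  nbhs (chart_at a p) (chart_at a @` (cdom (chart_at a) `&` U)).
Proof.
by move=> oU ap Up; apply: open_nbhs_nbhs; split; [exact: chart_img_open|exists p].
Qed.

Lemma nbhs_chart_imgT a p : cdom (chart_at a) p ->
  nbhs (chart_at a p) (chart_at a @` cdom (chart_at a)).
Proof.
by move=> ap; apply: open_nbhs_nbhs; split; [exact: chart_img_openT|exists p].
Qed.

End Charts.
Arguments chart_img_openT {R n M} a.

Section LocalExpression.
Variable R : realType.

(** The expression of a map [J] in the charts of index [a] and [b]. *)
Definition chart_rep m n (M : manifold R m) (N : manifold R n) (J : M -> N)
    (a : M) (b : N) : 'rV[R]_m -> 'rV[R]_n :=
  chart_at b \o J \o cbwd (chart_at a).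

Lemma smooth_map_id n (M : manifold R n) : smooth_map (@id M).
Proof. by split=> [x|a b]; [exact: cvg_id|exact: (@chart_compat _ _ M a b)]. Qed.

Lemma smooth_chart_rep m n (M : manifold R m) (N : manifold R n) (J : M -> N) a b :
  smooth_map J ->
  smooth_on (chart_at a @` (cdom (chart_at a) `&` J @^-1` cdom (chart_at b)))
            (chart_rep J a b).
Proof. by case. Qed.
Arguments smooth_chart_rep {m n M N J} a b _.

Lemma open_preimage_cdom m n (M : manifold R m) (N : manifold R n) (J : M -> N) b :
  smooth_map J -> open (J @^-1` cdom (chart_at b)).
Proof. by case=> cJ _; apply: open_comp (@cdom_open _ _ _ _) => x _; apply: cJ. Qed.

Lemma differentiable_chart_rep m n (M : manifold R m) (N : manifold R n)
    (J : M -> N) a b p :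
  smooth_map J -> cdom (chart_at a) p -> cdom (chart_at b) (J p) ->
  differentiable (chart_rep J a b) (chart_at a p).
Proof.
move=> sJ ap bp; have H := smooth_chart_rep a b sJ.
by apply: (smooth_on_differentiable H); exists p.
Qed.

Lemma chart_repE m n (M : manifold R m) (N : manifold R n) (J : M -> N) a b p :
  cdom (chart_at a) p -> chart_rep J a b (chart_at a p) = chart_at b (J p).
Proof. by move=> ap; rewrite /chart_rep /= cbwdK. Qed.

Lemma jacobian_chart_rep_comp m n k (M : manifold R m) (N : manifold R n)
    (Q : manifold R k) (J : M -> N) (K : N -> Q) a b c p :
  smooth_map J -> smooth_map K -> cdom (chart_at a) p ->
  cdom (chart_at b) (J p) -> cdom (chart_at c) (K (J p)) ->
  jacobian (chart_rep (K \o J) a c) (chart_at a p)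
  = jacobian (chart_rep J a b) (chart_at a p)
    *m jacobian (chart_rep K b c) (chart_at b (J p)).
Proof.
move=> sJ sK ap bp cp.
have dJ := differentiable_chart_rep sJ ap bp.
have dK := differentiable_chart_rep sK bp cp.
have Ep := chart_repE J b ap; rewrite -Ep in dK *.
apply: etrans _ (jacobian_comp dJ dK).
apply/esym; apply: jacobian_near; last exact: differentiable_comp dJ dK.
have oJ := open_preimage_cdom b sJ.
apply: filterS (nbhs_chart_img oJ ap bp) => _ [q [aq bq] <-].
by rewrite /= chart_repE // chart_repE // chart_repE.
Qed.

Lemma dtransE n (M : manifold R n) (a b p : M) :
  dtrans a b p = jacobian (chart_rep (@id M) a b) (chart_at a p).
Proof. by []. Qed.

Lemma tangentE m n (M : manifold R m) (N : manifold R n) (J : M -> N) p :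
  tangent J p = jacobian (chart_rep J p (J p)) (chart_at p p).
Proof. by []. Qed.

(** The cocycle identity for changes of coordinates. *)
Lemma dtrans_trans n (M : manifold R n) (a b c p : M) :
  cdom (chart_at a) p -> cdom (chart_at b) p -> cdom (chart_at c) p ->
  dtrans a b p *m dtrans b c p = dtrans a c p.
Proof.
move=> ap bp cp; rewrite !dtransE.
have sid := @smooth_map_id n M.
by rewrite -(jacobian_chart_rep_comp (J := id) (K := id) (a := a) (b := b) (c := c)).
Qed.

Lemma dtrans_id n (M : manifold R n) (a p : M) :
  cdom (chart_at a) p -> dtrans a a p = 1%:M.
Proof.
move=> ap; apply: jacobian_near_id.
by apply: filterS (nbhs_chart_imgT ap) => _ [q aq <-]; rewrite /= cbwdK.
Qed.

Lemma dtransV n (M : manifold R n) (a b p : M) :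
  cdom (chart_at a) p -> cdom (chart_at b) p ->
  dtrans a b p *m dtrans b a p = 1%:M.
Proof. by move=> ap bp; rewrite dtrans_trans // dtrans_id. Qed.

(** The Jacobian of [J] in arbitrary charts, from the tangent map, which is
expressed in the charts of index [p] and [J p]. *)
Lemma jacobian_chart_rep m n (M : manifold R m) (N : manifold R n) (J : M -> N) a b p :
  smooth_map J -> cdom (chart_at a) p -> cdom (chart_at b) (J p) ->
  jacobian (chart_rep J a b) (chart_at a p)
  = dtrans a p p *m tangent J p *m dtrans (J p) b (J p).
Proof.
move=> sJ ap bp.
have sid := @smooth_map_id m M; have sid' := @smooth_map_id n N.
have pp := cdom_self p; have qq := cdom_self (J p).
rewrite dtransE tangentE dtransE -(jacobian_chart_rep_comp (J := id) (K := J)) //.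
by rewrite -(jacobian_chart_rep_comp (J := J) (K := id)).
Qed.

End LocalExpression.
Arguments smooth_chart_rep {R m n M N J} a b _.

(** * Expressions of fields in a chart *)

Section Representations.
Variables (R : realType) (n : nat) (M : manifold R n).
Implicit Types (a b p x : M).

Lemma vec_repE a X p : cdom (chart_at a) p ->
  vec_rep a X (chart_at a p) = X p *m dtrans p a p.
Proof. by move=> ap; rewrite /vec_rep /= cbwdK. Qed.

Lemma cov_repE a w p : cdom (chart_at a) p ->
  cov_rep a w (chart_at a p) = copull (dtrans a p p) (w p).
Proof. by move=> ap; rewrite /cov_rep /= cbwdK. Qed.

Lemma form_repE a B p : cdom (chart_at a) p ->
  form_rep a B (chart_at a p) = pull2 (dtrans a p p) (B p).
Proof. by move=> ap; rewrite /form_rep /= cbwdK. Qed.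

Lemma biv_repE a P p : cdom (chart_at a) p ->
  biv_rep a P (chart_at a p) = pull2 (dtrans p a p)^T (P p).
Proof. by move=> ap; rewrite /biv_rep /= cbwdK. Qed.

Lemma vec_rep_self X x : vec_rep x X (chart_at x x) = X x.
Proof. by rewrite vec_repE ?dtrans_id ?mulmx1 //; apply: cdom_self. Qed.

Lemma cov_rep_self w x : cov_rep x w (chart_at x x) = w x.
Proof.
by rewrite cov_repE /copull ?dtrans_id ?trmx1 ?mulmx1 //; apply: cdom_self.
Qed.

Lemma form_rep_self B x : form_rep x B (chart_at x x) = B x.
Proof.
by rewrite form_repE /pull2 ?dtrans_id ?trmx1 ?mulmx1 ?mul1mx //; apply: cdom_self.
Qed.

Lemma biv_rep_self P x : biv_rep x P (chart_at x x) = P x.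
Proof.
rewrite biv_repE /pull2 ?dtrans_id ?trmxK ?trmx1 ?mulmx1 ?mul1mx //; exact: cdom_self.
Qed.

Lemma sharp_rep a (P : M -> 'M[R]_n) w p : cdom (chart_at a) p ->
  sharp (biv_rep a P (chart_at a p)) (cov_rep a w (chart_at a p))
  = vec_rep a (fun q => sharp (P q) (w q)) (chart_at a p).
Proof.
move=> ap; rewrite biv_repE // cov_repE // vec_repE //.
have := dtransV (cdom_self p) ap; move: (dtrans p a p) (dtrans a p p) => T T' TT.
rewrite /sharp /copull /pull2 !trmx_mul !trmxK !mulmxA.
by rewrite -(mulmxA _ T'^T) -trmx_mul TT trmx1 mulmx1.
Qed.

Lemma flat_rep a (B : M -> 'M[R]_n) X p : cdom (chart_at a) p ->
  flat (form_rep a B (chart_at a p)) (vec_rep a X (chart_at a p))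
  = cov_rep a (fun q => flat (B q) (X q)) (chart_at a p).
Proof.
move=> ap; rewrite form_repE // cov_repE // vec_repE //.
have := dtransV (cdom_self p) ap; move: (dtrans p a p) (dtrans a p p) => T T' TT.
by rewrite /flat /copull /pull2 !mulmxA -(mulmxA _ T) TT mulmx1.
Qed.

Lemma ev_rep a w X p : cdom (chart_at a) p ->
  ev (cov_rep a w (chart_at a p)) (vec_rep a X (chart_at a p)) = ev (w p) (X p).
Proof.
move=> ap; rewrite cov_repE // vec_repE //.
have := dtransV (cdom_self p) ap; move: (dtrans p a p) (dtrans a p p) => T T' TT.
by rewrite /copull ev_mul trmxK -mulmxA TT mulmx1.
Qed.

Lemma cov_repB a w w' y :
  cov_rep a (fun q => w q - w' q) y = cov_rep a w y - cov_rep a w' y.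
Proof. by rewrite /cov_rep /copull mulmxBl. Qed.

Lemma form_repD a B B' y :
  form_rep a (fun q => B q + B' q) y = form_rep a B y + form_rep a B' y.
Proof. by rewrite /form_rep /pull2 mulmxDr mulmxDl. Qed.

Lemma form_rep_skew a B y : (forall p, skew (B p)) -> skew (form_rep a B y).
Proof. by move=> sB; apply: skew_pull. Qed.

Lemma biv_rep_skew a P y : (forall p, skew (P p)) -> skew (biv_rep a P y).
Proof. by move=> sP; apply: skew_pull. Qed.

(** Unlike [dtrans p a p], whose first index varies with the point, the Jacobian
of the change of coordinates between two fixed charts is smooth. *)
Lemma smooth_dtrans a x :
  smooth_on (chart_at a @` (cdom (chart_at a) `&` cdom (chart_at x)))
            (fun y => dtrans a x (cbwd (chart_at a) y)).
Proof.
have oE : open (chart_at a @` (cdom (chart_at a) `&` cdom (chart_at x))).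
  exact/chart_img_open/cdom_open.
have H := smooth_on_jacobian oE (smooth_chart_rep a x (@smooth_map_id R n M)).
by apply: (smooth_on_eq oE _ H) => _ [p [ap xp] <-]; rewrite dtransE cbwdK.
Qed.

End Representations.

Arguments smooth_dtrans {R n M} a x.

(** * Closed two-forms and pull-backs *)

Section ClosedForms.
Variable R : realType.

(** The cyclic sum computing the exterior derivative of a two-form from its
directional derivatives [D]. *)
Definition cyclic_sum n (D : 'rV[R]_n -> 'M[R]_n) (u v w : 'rV[R]_n) : R :=
  form2 (D u) v w + form2 (D v) w u + form2 (D w) u v.

Lemma eq_cyclic_sum n (D D' : 'rV[R]_n -> 'M[R]_n) u v w :
  (forall z, D z = D' z) -> cyclic_sum D u v w = cyclic_sum D' u v w.
Proof. by move=> E; rewrite /cyclic_sum !E. Qed.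

Lemma cyclic_sumD n (D D' : 'rV[R]_n -> 'M[R]_n) u v w :
  cyclic_sum (fun z => D z + D' z) u v w = cyclic_sum D u v w + cyclic_sum D' u v w.
Proof. by rewrite /cyclic_sum !form2D; ring. Qed.

Lemma closed_formD n (M : manifold R n) (B B' : M -> 'M[R]_n) :
  closed_form B -> closed_form B' -> closed_form (fun x => B x + B' x).
Proof.
move=> [sB kB cB] [sB' kB' cB']; split.
- move=> a; have oE := chart_img_openT a.
  by apply: smooth_on_eq (smooth_onD oE (sB a) (sB' a)) => // y _; rewrite form_repD.
- by move=> x; apply: skewD.
move=> x u v w; rewrite /dform2.
have inE : (chart_at x @` cdom (chart_at x)) (chart_at x x).
  by exists x => //; apply: cdom_self.
have E (z : 'rV[R]_n) : 'D_z (form_rep x (fun x => B x + B' x)) (chart_at x x) =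
    'D_z (form_rep x B) (chart_at x x) + 'D_z (form_rep x B') (chart_at x x).
  have -> : form_rep x (fun x => B x + B' x) = form_rep x B + form_rep x B'.
    by apply/funext => y; rewrite form_repD.
  by apply: deriveD; apply: diff_derivable;
    [apply: smooth_on_differentiable (sB x) _|apply: smooth_on_differentiable (sB' x) _].
apply: etrans (eq_cyclic_sum _ _ _ E) _; rewrite cyclic_sumD.
by apply: etrans (congr2 _ (cB x u v w) (cB' x u v w)) _; rewrite addr0.
Qed.

(** The pull-back of a closed two-form of an open set of the numerical space
is closed: the terms where the Jacobian is differentiated cancel by symmetry of
second derivatives. *)
Lemma local_pullback_closed m n (E : set 'rV[R]_m) (f : 'rV[R]_m -> 'rV[R]_n)
    (G : 'rV[R]_n -> 'M[R]_n) y :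
  open E -> smooth_on E f -> E y -> differentiable G (f y) -> skew (G (f y)) ->
  (forall u v w, form2 ('D_u G (f y)) v w + form2 ('D_v G (f y)) w u
                 + form2 ('D_w G (f y)) u v = 0) ->
  let F z := pull2 (jacobian f z) (G (f z)) in
  forall u v w, form2 ('D_u F y) v w + form2 ('D_v F y) w u
                 + form2 ('D_w F y) u v = 0.
Proof.
move=> oE sf Ey dG sG cG F u v w.
have df z : E z -> differentiable f z by move=> Ez; apply: smooth_on_differentiable sf _.
have dA : differentiable (jacobian f) y.
  by apply: smooth_on_differentiable (smooth_on_jacobian oE sf) _.
have dGf : differentiable (G \o f) y by apply: differentiable_comp => //; apply: df.
pose A := jacobian f y.
(* the derivative of the Jacobian is the second derivative of f *)
have hess (a b : 'rV[R]_m) : b *m 'D_a (jacobian f) y = 'D_a ('D_b f) y.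
  have -> : 'D_a ('D_b f) y = 'D_a (fun z => b *m jacobian f z) y.
    apply: derive_eq_on Ey => // z Ez; exact: deriveEjacobian (df z Ez).
  by rewrite (derive_mulmx _ (f := fun=> b)) // derive_cst mul0mx add0r.
have dF (a b c : 'rV[R]_m) : form2 ('D_a F y) b c =
    form2 (G (f y)) ('D_a ('D_b f) y) (c *m A)
    + form2 ('D_(a *m A) G (f y)) (b *m A) (c *m A)
    + form2 (G (f y)) (b *m A) ('D_a ('D_c f) y).
  have -> : 'D_a F y = 'D_a (jacobian f) y *m G (f y) *m A^T
       + A *m 'D_(a *m A) G (f y) *m A^T + A *m G (f y) *m ('D_a (jacobian f) y)^T.
    rewrite /F /pull2 derive_mulmx;
      [|exact: differentiable_mulmx dA dGf|exact: differentiable_trmx].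
    rewrite derive_trmx // (derive_mulmx _ dA dGf) mulmxDl.
    by rewrite (derive_comp _ (df y Ey) dG) (deriveEjacobian _ (df y Ey)).
  rewrite -!hess; move: ('D_a (jacobian f) y) ('D_(a *m A) G (f y)) => DA DG.
  rewrite !form2D; congr (_ + _ + _).
  + by rewrite /form2 trmx_mul !mulmxA.
  + by rewrite -[A *m DG *m _]/(pull2 A DG) form2_pull.
  + by rewrite /form2 trmx_mul !mulmxA.
have sym (a b : 'rV[R]_m) : 'D_a ('D_b f) y = 'D_b ('D_a f) y.
  exact: derive_derive_sym_mx oE sf Ey.
(* from here on only the symmetry of the second derivatives h matters *)
have [h [g [{}dF {}sym {}cG]]] : exists (h : 'rV[R]_m -> 'rV[R]_m -> 'rV[R]_n)
    (g : 'rV[R]_n -> 'M[R]_n), [/\ forall a b c, form2 ('D_a F y) b c =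
      form2 (G (f y)) (h a b) (c *m A) + form2 (g (a *m A)) (b *m A) (c *m A)
      + form2 (G (f y)) (b *m A) (h a c),
      forall a b, h a b = h b a &
      forall u v w, form2 (g u) v w + form2 (g v) w u + form2 (g w) u v = 0].
  by exists (fun a b => 'D_a ('D_b f) y), (fun a => 'D_a G (f y)).
apply: etrans (congr2 +%R (congr2 +%R (dF u v w) (dF v w u)) (dF w u v)) _.
rewrite (sym v u) (sym w u) (sym w v).
have := cG (u *m A) (v *m A) (w *m A).
move: (form2 (g _) _ _) (form2 (g _) _ _) (form2 (g _) _ _) => g1 g2 g3 g0.
rewrite (form2_skew (v *m A) (h u w) sG) (form2_skew (w *m A) (h u v) sG).
rewrite (form2_skew (u *m A) (h v w) sG).
have -> : g3 = - g1 - g2 by apply/eqP; rewrite -subr_eq0 -g0; apply/eqP; ring.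
ring.
Qed.

(** The expression of a pull-back in charts is the pull-back of the expression. *)
Lemma form_rep_pullback m n (M : manifold R m) (N : manifold R n) (J : M -> N)
    (B : N -> 'M[R]_n) a b p :
  smooth_map J -> cdom (chart_at a) p -> cdom (chart_at b) (J p) ->
  form_rep a (pullback2 J B) (chart_at a p) =
  pull2 (jacobian (chart_rep J a b) (chart_at a p))
        (form_rep b B (chart_rep J a b (chart_at a p))).
Proof.
move=> sJ ap bp; rewrite chart_repE // !form_repE // jacobian_chart_rep //.
rewrite /pullback2; have := dtransV (cdom_self (J p)) bp.
move: (dtrans (J p) b _) (dtrans b _ _) (dtrans a _ _) => T T' U TT.
rewrite /pull2 !trmx_mul !mulmxA -(mulmxA _ T) TT mulmx1.
by rewrite -(mulmxA _ T'^T) -trmx_mul TT trmx1 mulmx1.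
Qed.

Lemma closed_form_pullback m n (M : manifold R m) (N : manifold R n) (J : M -> N)
    (B : N -> 'M[R]_n) :
  smooth_map J -> closed_form B -> closed_form (pullback2 J B).
Proof.
move=> sJ [sB kB cB].
have opE a b : open (chart_at a @` (cdom (chart_at a) `&` J @^-1` cdom (chart_at b))).
  by apply: chart_img_open; apply: open_preimage_cdom.
split.
- move=> a; apply: smooth_on_local => _ [p ap <-].
  pose b := J p; have bp : cdom (chart_at b) (J p) by apply: cdom_self.
  exists (chart_at a @` (cdom (chart_at a) `&` J @^-1` cdom (chart_at b))).
  split; first by exists p.
  have sf := smooth_chart_rep a b sJ; have oE := opE a b.
  apply: (@smooth_on_eq _ _ _ _ (fun z => pull2 (jacobian (chart_rep J a b) z)
        (form_rep b B (chart_rep J a b z)))) => //.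
    by move=> _ [q [aq bq] <-]; rewrite (form_rep_pullback _ (b := b)).
  have sA := smooth_on_jacobian oE sf.
  apply: smooth_on_mulmx => //; last exact: smooth_on_trmx.
  apply: smooth_on_mulmx => //.
  apply: (@smooth_on_comp _ _ _ _ _ _ (chart_at b @` cdom (chart_at b))) => //.
    exact: chart_img_openT.
  by move=> _ [q [aq bq] <-]; rewrite chart_repE //; exists (J q).
- by move=> x; apply: skew_pull.
move=> x u v w; rewrite /dform2.
have xx := cdom_self x; have bb := cdom_self (J x).
have oE := opE x (J x).
have xE : (chart_at x @` (cdom (chart_at x) `&` J @^-1` cdom (chart_at (J x)))) (chart_at x x).
  by exists x.
have EF (z : 'rV[R]_m) : 'D_z (form_rep x (pullback2 J B)) (chart_at x x) =
    'D_z (fun y => pull2 (jacobian (chart_rep J x (J x)) y)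
        (form_rep (J x) B (chart_rep J x (J x) y))) (chart_at x x).
  apply: derive_eq_on xE => // _ [q [aq bq] <-].
  exact: form_rep_pullback.
apply: etrans (eq_cyclic_sum _ _ _ EF) _.
apply: (local_pullback_closed oE (smooth_chart_rep x (J x) sJ) xE).
- rewrite chart_repE //; apply: smooth_on_differentiable (sB (J x)) _.
  by exists (J x).
- exact: form_rep_skew.
- by move=> u' v' w'; rewrite chart_repE //; apply: cB.
Qed.

End ClosedForms.

(** * Gauge transformations of Poisson structures *)

Section SmoothFields.
Variables (R : realType) (n : nat) (M : manifold R n).
Implicit Types (U : set M) (P B : M -> 'M[R]_n) (X w : M -> 'rV[R]_n).

Lemma smooth_vec_sharp U P w : open U ->
  smooth_biv P -> smooth_cov U w -> smooth_vec U (fun p => sharp (P p) (w p)).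
Proof.
move=> oU sP sw a; have oE := chart_img_open (a := a) oU.
have sP' : smooth_on (chart_at a @` (cdom (chart_at a) `&` U)) (biv_rep a P).
  by apply: smooth_on_sub (sP a) => _ [p [ap _] <-]; exists p.
have H := smooth_on_mulmx oE (sw a) (smooth_on_trmx oE sP').
by apply: (smooth_on_eq oE _ H) => _ [p [ap _] <-]; apply: sharp_rep.
Qed.

Lemma smooth_cov_flat U B X : open U ->
  smooth_form B -> smooth_vec U X -> smooth_cov U (fun p => flat (B p) (X p)).
Proof.
move=> oU sB sX a; have oE := chart_img_open (a := a) oU.
have sB' : smooth_on (chart_at a @` (cdom (chart_at a) `&` U)) (form_rep a B).
  by apply: smooth_on_sub (sB a) => _ [p [ap _] <-]; exists p.
have H := smooth_on_mulmx oE (sX a) sB'.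
by apply: (smooth_on_eq oE _ H) => _ [p [ap _] <-]; apply: flat_rep.
Qed.

Lemma smooth_covD U w w' : open U ->
  smooth_cov U w -> smooth_cov U w' -> smooth_cov U (fun p => w p + w' p).
Proof.
move=> oU sw sw' a; have oE := chart_img_open (a := a) oU.
apply: (smooth_on_eq oE _ (smooth_onD oE (sw a) (sw' a))) => y _.
by rewrite /cov_rep /copull mulmxDl.
Qed.

(** The covector field with constant coordinates [c] in the chart of index
[x]. *)
Definition const_cov (x : M) (c : 'rV[R]_n) : M -> 'rV[R]_n :=
  fun p => copull (dtrans p x p) c.

Lemma smooth_const_cov x c : smooth_cov (cdom (chart_at x)) (const_cov x c).
Proof.
move=> a; have oE := chart_img_open (a := a) (@cdom_open _ _ _ (chart_at x)).
have H := smooth_on_mulmx oE (smooth_on_cst c oE) (smooth_on_trmx oE (smooth_dtrans a x)).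
apply: (smooth_on_eq oE _ H) => _ [p [ap xp] <-].
have E := cov_repE (const_cov x c) ap.
apply: etrans _ (esym E).
rewrite /const_cov.
rewrite (cbwdK ap).
have TT := dtrans_trans ap (cdom_self p) xp.
rewrite -TT.
move: (dtrans a p p) (dtrans p x p) => T T'.
by rewrite /copull trmx_mul mulmxA.
Qed.

End SmoothFields.

Section GaugeDirac.
Variables (R : realType) (n : nat) (M : manifold R n).
Variables (P B : M -> 'M[R]_n).
Hypotheses (pP : poisson P) (cB : closed_form B).

(** A local frame is made of the sections whose underlying covectors are the
coordinate covectors of the chart. *)
Lemma gauge_smooth_subbundle : smooth_subbundle (gauge B (graph_biv P)).
Proof.
have [sP kP _] := pP; have [sB kB _] := cB.
move=> x.
pose eta (i : 'I_n) := const_cov x 'e_i.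
pose X i p := sharp (P p) (eta i p).
exists (cdom (chart_at x)), n, (fun i p => (X i p, eta i p + flat (B p) (X i p))).
have oU := @cdom_open _ _ _ (chart_at x).
split=> //; first exact: cdom_self.
- move=> i; have se : smooth_cov (cdom (chart_at x)) (eta i) by apply: smooth_const_cov.
  have sX : smooth_vec (cdom (chart_at x)) (X i) by apply: smooth_vec_sharp.
  by split=> //; apply: smooth_covD => //; apply: smooth_cov_flat.
- by move=> y _ i; exists (X i y, eta i y).
move=> y xy z [[Z ze] Eze ->] /=.
have {}Eze : Z = sharp (P y) ze := Eze.
have TT := dtransV (cdom_self y) xy; have T'T := mulmx1C TT.
have sumeta (c : 'I_n -> R) :
    \sum_i c i *: eta i y = (\row_i c i) *m (dtrans y x y)^T.
  rewrite [X in X *m _]row_sum_delta mulmx_suml; apply: eq_bigr => i _.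
  by rewrite mxE -scalemxAl.
have sumX (c : 'I_n -> R) : \sum_i c i *: X i y = sharp (P y) (\sum_i c i *: eta i y).
  by rewrite /sharp mulmx_suml; apply: eq_bigr => i _; rewrite -scalemxAl.
have sumom (c : 'I_n -> R) : \sum_i c i *: (eta i y + flat (B y) (X i y)) =
    \sum_i c i *: eta i y + flat (B y) (\sum_i c i *: X i y).
  rewrite /flat mulmx_suml -big_split /=; apply: eq_bigr => i _.
  by rewrite scalerDr -scalemxAl.
exists (fun i => (ze *m (dtrans x y y)^T) 0 i); split.
  have Ese : \sum_i (ze *m (dtrans x y y)^T) 0 i *: eta i y = ze.
    rewrite sumeta (_ : \row_i _ = ze *m (dtrans x y y)^T); last first.
      by apply/rowP => i; rewrite mxE.
    by rewrite -mulmxA -trmx_mul TT trmx1 mulmx1.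
  by rewrite sumom sumX Ese Eze.
move=> c [EZ]; rewrite sumom -EZ => /addIr; rewrite sumeta => Ec.
apply/funext => i; rewrite Ec -mulmxA -trmx_mul T'T trmx1 mulmx1.
by rewrite mxE.
Qed.

Lemma dirac_gauge : dirac (gauge B (graph_biv P)).
Proof.
have [sP kP schP] := pP; have [sB kB dB0] := cB.
split; first by move=> x; apply: linear_dirac_gauge.
  exact: gauge_smooth_subbundle.
move=> z1 z2 [sX som L1] [sY smu L2] x.
pose y0 := chart_at x x.
have y0E : (chart_at x @` cdom (chart_at x)) y0 by exists x => //; apply: cdom_self.
have y0ET : (chart_at x @` (cdom (chart_at x) `&` setT)) y0 by rewrite setIT.
have nE := nbhs_chart_imgT (cdom_self x).
pose X := vec_rep x (fst \o z1); pose om := cov_rep x (snd \o z1).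
pose Y := vec_rep x (fst \o z2); pose mu := cov_rep x (snd \o z2).
have dX : differentiable X y0 by apply: smooth_on_differentiable (sX x) y0ET.
have dY : differentiable Y y0 by apply: smooth_on_differentiable (sY x) y0ET.
have dom : differentiable om y0 by apply: smooth_on_differentiable (som x) y0ET.
have dmu : differentiable mu y0 by apply: smooth_on_differentiable (smu x) y0ET.
have dP : differentiable (biv_rep x P) y0 by apply: smooth_on_differentiable (sP x) y0E.
have dB : differentiable (form_rep x B) y0 by apply: smooth_on_differentiable (sB x) y0E.
have secE (z : M -> dbl R n) : (forall p, gauge B (graph_biv P) p (z p)) ->
    \forall y \near y0, vec_rep x (fst \o z) y = sharp (biv_rep x P y)
      (cov_rep x (snd \o z) y - flat (form_rep x B y) (vec_rep x (fst \o z) y)).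
  move=> Lz; apply: filterS nE => _ [p xp <-].
  rewrite flat_rep // -cov_repB sharp_rep // !vec_repE //; congr (_ *m _) => /=.
  by have [[Z ze] EZ ->] := Lz p; rewrite /= addrK.
have H := @lcourant_gauge R n (biv_rep x P) (form_rep x B) X Y om mu y0
  dP dB dX dY dom dmu.
have EC1 : lie_bracket (fst \o z1) (fst \o z2) x = lbracket X Y y0.
  by rewrite /lie_bracket /lbracket /X /Y !vec_rep_self.
have EC2 : (courant z1 z2 x).2 = lcourant X om Y mu y0.
  rewrite /courant /lie_cov /lcourant /X /om /Y /mu !vec_rep_self !cov_rep_self.
  congr (_ + _ *: _); apply/rowP => i; rewrite !mxE.
  apply: near_eq_derive; apply: filterS nE => _ [p xp <-].
  have E1 := ev_rep (snd \o z1) (fst \o z2) xp.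
  have E2 := ev_rep (snd \o z2) (fst \o z1) xp.
  apply: etrans _ (esym (congr2 (fun a b : R => a - b) E1 E2)).
  exact: (congr1 (fun q => ev (z1 q).2 (z2 q).1 - ev (z2 q).2 (z1 q).1) (cbwdK xp)).
have -> : courant z1 z2 x = (lbracket X Y y0, lcourant X om Y mu y0).
  by rewrite -EC1 -EC2.
rewrite /gauge /graph_biv -(form_rep_self B) -(biv_rep_self P).
apply: H.
- by near=> y; apply: biv_rep_skew.
- by near=> y; apply: form_rep_skew.
- exact: secE.
- exact: secE.
- exact: dB0.
- by rewrite biv_rep_self; apply: schP.
Unshelve. all: by end_near. Qed.

Lemma poisson_gauge : (forall p, 1%:M + (P p)^T *m B p \in unitmx) ->
  poisson (fun p => gauge_biv (B p) (P p)).
Proof.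
have [sP kP schP] := pP; have [sB kB dB0] := cB.
move=> uN.
have rep a p : cdom (chart_at a) p ->
    1%:M + (biv_rep a P (chart_at a p))^T *m form_rep a B (chart_at a p) \in unitmx
    /\ gauge_biv (form_rep a B (chart_at a p)) (biv_rep a P (chart_at a p))
    = biv_rep a (fun p => gauge_biv (B p) (P p)) (chart_at a p).
  move=> ap; rewrite !biv_repE // form_repE //; apply: gauge_biv_pull => //.
  by apply: dtransV => //; apply: cdom_self.
have sP' : smooth_biv (fun p => gauge_biv (B p) (P p)).
  move=> a; have oE := chart_img_openT a.
  have sPT := smooth_on_trmx oE (sP a).
  have sN := smooth_onD oE (smooth_on_cst 1%:M oE) (smooth_on_mulmx oE sPT (sB a)).
  have uN' y : (chart_at a @` cdom (chart_at a)) y ->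
      1%:M + (biv_rep a P y)^T *m form_rep a B y \in unitmx.
    by move=> [p ap <-]; have [] := rep a p ap.
  have H := smooth_on_trmx oE (smooth_on_mulmx oE (smooth_on_invmx oE uN' sN) sPT).
  by apply: (smooth_on_eq oE _ H) => _ [p ap <-]; have [_ <-] := rep a p ap.
split; first exact: sP'.
  by move=> x; apply: gauge_biv_skew.
move=> x al be ga.
have y0E : (chart_at x @` cdom (chart_at x)) (chart_at x x).
  by exists x => //; apply: cdom_self.
have nE := nbhs_chart_imgT (cdom_self x).
have Ex := biv_rep_self (fun p => gauge_biv (B p) (P p)) x.
rewrite /schouten -[gauge_biv (B x) (P x)]Ex.
apply: (@schouten_gauge_biv R n (biv_rep x P) (form_rep x B)).
- by apply: smooth_on_differentiable (sP x) y0E.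
- by apply: smooth_on_differentiable (sB x) y0E.
- by apply: smooth_on_differentiable (sP' x) y0E.
- by near=> y; apply: biv_rep_skew.
- by near=> y; apply: form_rep_skew.
- by apply: filterS nE => _ [p ap <-]; have [] := rep x p ap.
- by apply: filterS nE => _ [p ap <-]; have [_ <-] := rep x p ap.
- exact: dB0.
- by rewrite biv_rep_self; apply: schP.
Unshelve. all: by end_near. Qed.

End GaugeDirac.

(** * Gauge transformations of dual pairs *)

(** The bivector on the target of a Poisson map from a symplectic manifold, in
terms of the symplectic form and of the tangent map. *)
Lemma poisson_map_pull2 (R : realType) m n (M : manifold R m) (N : manifold R n)
    (W : M -> 'M[R]_m) (P : N -> 'M[R]_n) (J : M -> N) x :
  poisson_map (symp_biv W) P J ->
  (P (J x))^T = (tangent J x)^T *m invmx (W x) *m tangent J x.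
Proof.
move=> [_ H]; have -> : P (J x) = pull2 (tangent J x)^T (symp_biv W x).
  by apply: form2_inj => al be; rewrite form2_pull H.
by rewrite /pull2 /symp_biv !trmx_mul !trmxK mulmxA.
Qed.

Theorem theorem3p6 (R : realType) (s n1 n2 : nat)
    (S : manifold R s) (M1 : manifold R n1) (M2 : manifold R n2)
    (Omega : S -> 'M[R]_s) (pi1 : M1 -> 'M[R]_n1) (pi2 : M2 -> 'M[R]_n2)
    (J1 : S -> M1) (J2 : S -> M2)
    (B1 : M1 -> 'M[R]_n1) (B2 : M2 -> 'M[R]_n2) :
  full_dual_pair Omega J1 J2 pi1 pi2 ->
  closed_form B1 -> closed_form B2 ->
  let Omega' :=
    fun x : S => Omega x + pullback2 J1 B1 x + pullback2 J2 B2 x in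
  [/\ full_pre_dual_pair Omega' J1 J2
        (gauge B1 (graph_biv pi1)) (gauge B2 (graph_biv pi2)),
      symplectic Omega' <->
        is_poisson (gauge B1 (graph_biv pi1)) /\
        is_poisson (gauge B2 (graph_biv pi2)) &
      symplectic Omega' ->
        exists (pi1' : M1 -> 'M[R]_n1) (pi2' : M2 -> 'M[R]_n2),
          [/\ graph_biv pi1' = gauge B1 (graph_biv pi1),
              graph_biv pi2' = gauge B2 (graph_biv pi2) &
              full_dual_pair Omega' J1 J2 pi1' pi2']].
Proof.
move=> [[[cO uO] [po1 po2] pm1 pm2 kerE] sub1 sub2] cB1 cB2 Omega'.
have [sm1 surj1 tan1] := sub1; have [sm2 surj2 tan2] := sub2.
have lin x : lin_dual (Omega x) (tangent J1 x) (tangent J2 x).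
  by split=> //; have [_ kO _] := cO.
have lin' x := lin_dualC (lin x).
have Q1 x := poisson_map_pull2 x pm1.
have Q2 x := poisson_map_pull2 x pm2.
have OE x : Omega' x = Omega x + pull2 (tangent J1 x) (B1 (J1 x))
                       + pull2 (tangent J2 x) (B2 (J2 x)) by [].
have OE' x : Omega' x = Omega x + pull2 (tangent J2 x) (B2 (J2 x))
                       + pull2 (tangent J1 x) (B1 (J1 x)) by rewrite OE addrAC.
have cO' : closed_form Omega' := closed_formD
  (closed_formD cO (closed_form_pullback sm1 cB1)) (closed_form_pullback sm2 cB2).
have fwd1 x : lforward (tangent J1 x) (lgraph_form (Omega' x))
    = lgauge (B1 (J1 x)) (lgraph_biv (pi1 (J1 x))).
  by rewrite OE; apply: lforward_gauge.
have fwd2 x : lforward (tangent J2 x) (lgraph_form (Omega' x))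
    = lgauge (B2 (J2 x)) (lgraph_biv (pi2 (J2 x))).
  by rewrite OE'; apply: lforward_gauge.
have orth1 x : orth (Omega' x) (lker_set (tangent J1 x))
    = set_sum (lker_set (tangent J2 x)) (form_ker (Omega' x)).
  by rewrite OE; apply: orth_gauge.
have orth2 x : orth (Omega' x) (lker_set (tangent J2 x))
    = set_sum (lker_set (tangent J1 x)) (form_ker (Omega' x)).
  by rewrite OE'; apply: orth_gauge.
have unit1 : symplectic Omega' -> forall p, 1%:M + (pi1 p)^T *m B1 p \in unitmx.
  move=> [_ uO'] p; have [x <-] := surj1 p.
  by have := uO' x; rewrite OE; apply: (unit_gauge_left (lin x) (Q1 x) (tan1 x)).
have unit2 : symplectic Omega' -> forall p, 1%:M + (pi2 p)^T *m B2 p \in unitmx.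
  move=> [_ uO'] p; have [x <-] := surj2 p.
  by have := uO' x; rewrite OE'; apply: (unit_gauge_left (lin' x) (Q2 x) (tan2 x)).
have graphE n (M : manifold R n) (P B : M -> 'M[R]_n) :
    (forall p, 1%:M + (P p)^T *m B p \in unitmx) ->
    graph_biv (fun p => gauge_biv (B p) (P p)) = gauge B (graph_biv P).
  by move=> uN; apply/funext => p; apply/esym; apply: lgauge_graph_biv.
split.
- split; [split|exact: sub1|exact: sub2] => //.
  by split; apply: dirac_gauge.
- split=> [sO'|[[P1 _ E1] [P2 _ E2]]].
    split.
      exists (fun p => gauge_biv (B1 p) (pi1 p)); last by rewrite graphE //; apply: unit1.
      by apply: poisson_gauge => //; apply: unit1.
    exists (fun p => gauge_biv (B2 p) (pi2 p)); last by rewrite graphE //; apply: unit2.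
    by apply: poisson_gauge => //; apply: unit2.
  split=> // x; rewrite OE; apply: (unit_gauge (lin x) (Q1 x) (Q2 x)).
    exact: lgauge_graph_biv_unit (congr1 (fun L => L (J1 x)) E1).
  exact: lgauge_graph_biv_unit (congr1 (fun L => L (J2 x)) E2).
move=> sO'; have u1 := unit1 sO'; have u2 := unit2 sO'; have [_ uO'] := sO'.
exists (fun p => gauge_biv (B1 p) (pi1 p)), (fun p => gauge_biv (B2 p) (pi2 p)).
split; [exact: graphE|exact: graphE|].
split; [split|exact: sub1|exact: sub2].
- exact: sO'.
- by split; apply: poisson_gauge.
- split; [exact: sm1|move=> x al be; apply: lforward_graph_biv; first exact: uO'].
  by rewrite fwd1 lgauge_graph_biv.
- split; [exact: sm2|move=> x al be; apply: lforward_graph_biv; first exact: uO'].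
  by rewrite fwd2 lgauge_graph_biv.
- by move=> x; rewrite orth2 set_sum_nondegenerate.
Qed.
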